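(* Under assumptions (A1)–(A4) stated in the context, as $n,p\to\infty$, for $\alpha,\beta=1,\dots,K$ with $\alpha\ne\beta$, $$\frac{\widehat{\operatorname{tr}(W\Sigma_\alpha)^2}}{\operatorname{tr}\big((W\Sigma_\alpha)^2\big)}\stackrel{p}{\longrightarrow}1,\qquad \frac{\operatorname{tr}(W\widehat\Sigma_\alpha W\widehat\Sigma_\beta)}{\operatorname{tr}(W\Sigma_\alpha W\Sigma_\beta)}\stackrel{p}{\longrightarrow}1,\qquad \frac{\widehat\sigma^2(T_{n_0})}{\sigma^2(T_{n_0})}\stackrel{p}{\longrightarrow}1.$$
   Context: Setting. $K\ge 2$ and $1\le q<K$ are fixed integers and $\widetilde G$ is a known real $q\times K$ matrix of rank $q$. For $\alpha=1,\dots,K$, $Y_{\alpha 1},\dots,Y_{\alpha n_\alpha}$ is an independent sample from a $p$-dimensional distribution with mean vector $\mu_\alpha$ and covariance matrix $\Sigma_\alpha$; the $K$ samples are independent of each other; $n=n_1+\cdots+n_K$. Let $D=\operatorname{diag}(n/n_1,\dots,n/n_K)$, $G=(\widetilde GD\widetilde G^T)^{-1/2}\widetilde G$ with columns $g_1,\dots,g_K$, and $d_{\alpha\beta}=g_\alpha^Tg_\beta$. Sums over $\alpha\ne\beta$ run over ordered pairs in $\{1,\dots,K\}$. Weight matrix. $W=B+\mathbf a\mathbf a^T$ is $p\times p$, where $\mathbf a=(a_1,\dots,a_p)^T$, $B=\operatorname{diag}(b_1^2,\dots,b_p^2)$, and $a_i$ and $b_i^2$ are the mean and variance of a given probability density function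 on $\mathbb R$, $i=1,\dots,p$. $W^{1/2}$ is the symmetric square root of $W$. Estimators. $\overline Y_\alpha=n_\alpha^{-1}\sum_{i=1}^{n_\alpha}Y_{\alpha i}$, $\widehat\Sigma_\alpha=(n_\alpha-1)^{-1}\sum_{i=1}^{n_\alpha}(Y_{\alpha i}-\overline Y_\alpha)(Y_{\alpha i}-\overline Y_\alpha)^T$, $Q_\alpha=(n_\alpha-1)^{-1}\sum_{i=1}^{n_\alpha}\|W^{1/2}(Y_{\alpha i}-\overline Y_\alpha)\|^4$, and $$\widehat{\operatorname{tr}(W\Sigma_\alpha)^2}=\frac{n_\alpha-1}{n_\alpha(n_\alpha-2)(n_\alpha-3)}\Big((n_\alpha-1)(n_\alpha-2)\operatorname{tr}\big((W\widehat\Sigma_\alpha)^2\big)+\big(\operatorname{tr}(W\widehat\Sigma_\alpha)\big)^2-n_\alpha Q_\alpha\Big).$$ Further $$\sigma^2(T_{n_0})=2\Big(\sum_{\alpha=1}^K\frac{d_{\alpha\alpha}^2\operatorname{tr}\big((W\Sigma_\alpha)^2\big)}{n_\alpha(n_\alpha-1)}+\sum_{\alpha\ne\beta}\frac{d_{\alpha\beta}^2\operatorname{tr}(W\Sigma_\alpha W\Sigma_\beta)}{n_\alpha n_\beta}\Big),$$ $$\widehat\sigma^2(T_{n_0})=2\Big(\sum_{\alpha=1}^K\frac{d_{\alpha\alpha}^2\,\widehat{\operatorname{tr}(W\Sigma_\alpha)^2}}{n_\alpha(n_\alpha-1)}+\sum_{\alpha\ne\beta}\frac{d_{\alpha\beta}^2\operatorname{tr}(W\widehat\Sigma_\alpha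 W\widehat\Sigma_\beta)}{n_\alpha n_\beta}\Big).$$ Assumptions. (A1) $Y_{\alpha i}=\Gamma_\alpha Z_{\alpha i}+\mu_\alpha$ for $i=1,\dots,n_\alpha$, $\alpha=1,\dots,K$, where $\Gamma_\alpha$ is a $p\times m$ matrix with $p\le m$ and $\Gamma_\alpha\Gamma_\alpha^T=\Sigma_\alpha$, and the $Z_{\alpha i}$ are i.i.d. $m$-dimensional random vectors with $E(Z_{\alpha i})=0$ and $\operatorname{Cov}(Z_{\alpha i})=I_m$. (A2) $E(z_{\alpha is}^4)=3+\Delta<\infty$, where $z_{\alpha is}$ is the $s$-th component of $Z_{\alpha i}$ and $\Delta$ is some constant; moreover $E(z_{\alpha is_1}^{\varsigma_1}\cdots z_{\alpha is_r}^{\varsigma_r})=E(z_{\alpha is_1}^{\varsigma_1})\cdots E(z_{\alpha is_r}^{\varsigma_r})$ for all positive integers $r$ and $\varsigma_1,\dots,\varsigma_r$ with $\sum_{s=1}^r\varsigma_s\le 8$ and all distinct indices $s_1,\dots,s_r$. (A3) $n_\alpha/n\to\tau_\alpha\in(0,1)$ as $n\to\infty$, for $\alpha=1,\dots,K$. (A4) As $p\to\infty$, for any $\alpha,\beta,\gamma\in\{1,\dots,K\}$, $\operatorname{tr}(W\Sigma_\alpha W\Sigma_\beta W\Sigma_\gamma W\Sigma_\beta)=o\{\operatorname{tr}(W\Sigma_\alpha W\Sigma_\beta)\operatorname{tr}(W\Sigma_\gamma W\Sigma_\beta)\}$. No relation between $p$ and $n$ is imposed; the quantities $m,\mu_\alpha,\Gamma_\alpha,\Sigma_\alpha,W$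 may vary with $p$. *)

(* Defs.v *)
From HB Require Import structures.
From mathcomp Require Import all_boot all_order all_algebra.
From mathcomp Require Import all_classical all_reals all_analysis.
Set Implicit Arguments.
Unset Strict Implicit.
Unset Printing Implicit Defensive.
Import Order.TTheory GRing.Theory Num.Theory.
Import numFieldNormedType.Exports.
Local Open Scope classical_set_scope.
Local Open Scope ring_scope.

Section Matrices.
Context {R : realType}.

(* Euclidean norm; the library's norm on matrices is the sup norm. *)
Definition norm2 p (x : 'cV[R]_p) : R := Num.sqrt (\sum_(i < p) x i 0 ^+ 2).

Definition psdmx p (A : 'M[R]_p) : Prop :=
  A^T = A /\ forall x : 'cV[R]_p, 0 <= (x^T *m A *m x) 0 0.

(* The symmetric positive semidefinite square root of A, unique when A is
   positive semidefinite; 0 when there is none. *)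
Definition sqrtmx p (A : 'M[R]_p) : 'M[R]_p :=
  xget 0 [set S | psdmx S /\ S *m S = A].

End Matrices.

Section Weight.
Context {R : realType}.

Definition is_pdf (f : R -> R) : Prop :=
  [/\ measurable_fun [set: R] f,
      forall x, 0 <= f x &
      (\int[lebesgue_measure]_x (f x)%:E = 1)%E].

Definition pdf_moment2_finite (f : R -> R) : Prop :=
  (@lebesgue_measure R).-integrable [set: R] (fun x => (x ^+ 2 * f x)%:E).

Definition pdf_mean (f : R -> R) : R := \int[lebesgue_measure]_x (x * f x).

Definition pdf_var (f : R -> R) : R :=
  \int[lebesgue_measure]_x ((x - pdf_mean f) ^+ 2 * f x).

Definition weightmx p (f : 'I_p -> R -> R) : 'M[R]_p :=
  let a : 'cV[R]_p := \col_i pdf_mean (f i) in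
  diag_mx (\row_i pdf_var (f i)) + a *m a^T.

End Weight.

Section Contrast.
Context {R : realType}.
Variables (K q : nat) (Gt : 'M[R]_(q, K)) (N : 'I_K -> nat).

Definition ratio_mx : 'M[R]_K :=
  diag_mx (\row_alpha ((\sum_beta N beta)%N%:R / (N alpha)%:R)).

Definition contrast_mx : 'M[R]_(q, K) :=
  invmx (sqrtmx (Gt *m ratio_mx *m Gt^T)) *m Gt.

Definition contrast_coef (alpha beta : 'I_K) : R :=
  ((col alpha contrast_mx)^T *m col beta contrast_mx) 0 0.

End Contrast.

Section Estimators.
Context {R : realType}.
Variable p : nat.

Definition sample_mean N (y : 'I_N -> 'cV[R]_p) : 'cV[R]_p :=
  N%:R^-1 *: \sum_(i < N) y i.

Definition sample_cov N (y : 'I_N -> 'cV[R]_p) : 'M[R]_p :=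
  (N%:R - 1)^-1 *:
    \sum_(i < N) (y i - sample_mean y) *m (y i - sample_mean y)^T.

Variable W : 'M[R]_p.

Definition Qstat N (y : 'I_N -> 'cV[R]_p) : R :=
  (N%:R - 1)^-1 * \sum_(i < N) norm2 (sqrtmx W *m (y i - sample_mean y)) ^+ 4.

Definition trsq_est N (y : 'I_N -> 'cV[R]_p) : R :=
  let n : R := N%:R in
  let WS := W *m sample_cov y in
  (n - 1) / (n * (n - 2) * (n - 3)) *
    ((n - 1) * (n - 2) * \tr (WS *m WS) + (\tr WS) ^+ 2 - n * Qstat y).

Variables (K q : nat) (Gt : 'M[R]_(q, K)) (N : 'I_K -> nat).

Definition sigma2 (Sigma : 'I_K -> 'M[R]_p) : R :=
  2 * ((\sum_alpha contrast_coef Gt N alpha alpha ^+ 2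
          * \tr (W *m Sigma alpha *m (W *m Sigma alpha))
          / ((N alpha)%:R * ((N alpha)%:R - 1)))
     + \sum_alpha \sum_(beta | alpha != beta)
          contrast_coef Gt N alpha beta ^+ 2
          * \tr (W *m Sigma alpha *m W *m Sigma beta)
          / ((N alpha)%:R * (N beta)%:R)).

Definition sigma2_est (y : forall alpha, 'I_(N alpha) -> 'cV[R]_p) : R :=
  2 * ((\sum_alpha contrast_coef Gt N alpha alpha ^+ 2
          * trsq_est (y alpha)
          / ((N alpha)%:R * ((N alpha)%:R - 1)))
     + \sum_alpha \sum_(beta | alpha != beta)
          contrast_coef Gt N alpha beta ^+ 2
          * \tr (W *m sample_cov (y alpha) *m W *m sample_cov (y beta))
          / ((N alpha)%:R * (N beta)%:R)).

End Estimators.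

Section Probability.
Context {R : realType} d (T : measurableType d) (P : probability T R).

Definition iid d' (T' : measurableType d') (I : finType)
    (X : I -> {RV P >-> T'}) : Prop :=
  (forall (J : {set I}) (A : I -> set T'),
      (forall i, measurable (A i)) ->
      (P (\bigcap_(i in [set` J]) (X i @^-1` A i))
       = \prod_(i in J) P (X i @^-1` A i))%E)
  /\ (forall (i j : I) (A : set T'), measurable A ->
        distribution P (X i) A = distribution P (X j) A).

Variable m : nat.

(* A random vector of dimension m takes values in m.-tuple R, which carries
   the product sigma-algebra. *)
Definition component (z : T -> m.-tuple R) (s : 'I_m) : T -> R :=
  fun w => tnth (z w) s.

Definition standardized (z : T -> m.-tuple R) : Prop :=
  (forall s, 'E_P[component z s] = 0)%E /\
  (forall s t, covariance P (component z s) (component z t)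
               = ((s == t)%:R : R)%:E).

(* Expectations are extended-real: the first clause makes the fourth moments
   finite, and the factorization is an identity in \bar R. *)
Definition moment_conditions (Delta : R) (z : T -> m.-tuple R) : Prop :=
  (forall s, 'E_P[fun w => (component z s w ^+ 4)%R] = (3 + Delta)%:E)%E /\
  (forall (r : nat) (s : 'I_r -> 'I_m) (c : 'I_r -> nat),
     (0 < r)%N -> injective s -> (forall j, 0 < c j)%N ->
     (\sum_j c j <= 8)%N ->
     ('E_P[fun w => (\prod_j component z (s j) w ^+ c j)%R]
      = \prod_j 'E_P[fun w => (component z (s j) w ^+ c j)%R])%E).

Definition col_of_tuple (v : m.-tuple R) : 'cV[R]_m := \col_s tnth v s.

End Probability.

(* Convergence in probability to l as n and p tend jointly to infinity; the
   probability space may change with (n, p). *)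
Definition cvg_prob {R : realType} (d : nat -> nat -> measure_display)
    (T : forall n p, measurableType (d n p))
    (P : forall n p, probability (T n p) R)
    (X : forall n p, T n p -> R) (l : R) : Prop :=
  forall eps : R, 0 < eps ->
    P i.1 i.2 [set w | eps < `|X i.1 i.2 w - l|]
      @[i --> filter_prod \oo \oo] --> 0%E.

(* Main.v *)
(* Fix n and p, put M = Gamma_alpha^T W Gamma_beta and let c_ij = z_i^T M z'_j,
   where z_i and z'_j are the standardized vectors behind the i-th observation of
   sample alpha and the j-th of sample beta.  Then tr(W Sigma_alpha W Sigma_beta)
   is the squared Frobenius norm theta of M.  Each estimator is a multiple of the
   sum of the c_ij^2, corrected by squared row, column and total sums of the c_ij;
   for alpha = beta the diagonal terms c_ii cancel.  As c_ij and c_kl are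
   uncorrelated unless {i,j} = {k,l}, the corrections have expectation O(theta/n)
   and are negligible in L^1.  The main term converges in L^2: c_ij^2 and c_kl^2
   are independent for disjoint index pairs, and E c_ij^4 <= (3 + |Delta|)^2 theta^2.
   This gives P(eps < |ratio - 1|) <= C (1/n_alpha + 1/n_beta) with C depending on
   eps and Delta only, whence convergence uniformly in p.
   The ratio of the variances is a weighted average of the other ratios, with
   nonnegative weights whose sum is positive because Gt has full rank. *)
Require Import Defs.
From HB Require Import structures.
From mathcomp Require Import all_boot all_order all_algebra.
From mathcomp Require Import all_classical all_reals all_analysis.
From mathcomp Require Import measurable_realfun zify ring lra.
From mathcomp Require complex.
Set Implicit Arguments.
Unset Strict Implicit.
Unset Printing Implicit Defensive.
Import Order.TTheory GRing.Theory Num.Theory.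
Import numFieldNormedType.Exports.
Local Open Scope classical_set_scope.
Local Open Scope ring_scope.

(** * Positive semidefinite matrices and the estimators as quadratic forms *)

(** All bounds are relative to theta, which is why p never enters them. (A2) guarantees finite
    moments of one vector only up to degree four, and this shapes the argument. A product of four
    forms c_ij has eight coordinates; for i different from j no vector contributes more than four of
    them, whereas the fourth power of c_ii would need eighth moments. The cancellation of the
    diagonal is thus what makes an L^2 bound available for the same-sample estimator. The
    corrections are nonnegative, so their expectations already are L^1 norms and second moments of
    the forms suffice for them. Every expectation is found by expanding the forms into monomials in
    the coordinates and regrouping these by vector: independence separates the vectors, and a table
    of moments settles each one. Independence is assumed for events, so the product rule for
    expectations has to be derived before it can be used. *)

Lemma interpolation (F : fieldType) (g : F -> F) (s : seq F) :
  exists r : {poly F}, {in s, forall x, r.[x] = g x}.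
Proof.
elim: s => [|a s [r rP]]; first by exists 0.
have [as_|aNs] := boolP (a \in s).
  by exists r => x; rewrite inE => /predU1P[->|]; exact: rP.
(* Newton's form: [w] vanishes at the nodes already treated, so adding a multiple of it corrects the
   value at [a] alone. *)
pose w : {poly F} := \prod_(x <- s) ('X - x%:P).
have wa : w.[a] != 0.
  rewrite horner_prod prodf_seq_neq0; apply/allP => x xs /=.
  by rewrite hornerXsubC subr_eq0; apply: contraNneq aNs => ->.
exists (r + ((g a - r.[a]) / w.[a]) *: w) => x.
rewrite inE hornerD hornerZ => /predU1P[->|xs]; first by rewrite divfK// subrKC.
rewrite rP//.
have /eqP -> : w.[x] == 0 by rewrite -[_ == _]/(root w x) root_prod_XsubC.
by rewrite mulr0 addr0.
Qed.

Module Import SquareRoot.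
Import complex.

Section SquareRoot.
Variable R : realType.
Local Open Scope sesquilinear_scope.
Local Open Scope complex_scope.
Local Notation C := (R[i]).
Local Notation toC := (real_complex R).

(* The square root is r(A)^2, where the real polynomial r interpolates the
   fourth root on the spectrum of A; this avoids showing that a complex square
   root is real. *)
Lemma psdmx_sqrt p (A : 'M[R]_p) : psdmx A -> exists S, psdmx S /\ S *m S = A.
Proof.
case: p A => [|p] A [As A0].
  exists 0; split; last by apply/matrixP => -[].
  by split=> [|x]; rewrite ?trmx0// mulmx0 mul0mx mxE.
pose AC : 'M[C]_p.+1 := map_mx toC A.
have conjR (x : R) : Num.conj (toC x) = toC x by exact: conjc_real.
have ACs : AC \is hermsymmx.
  apply/is_hermitianmxP; rewrite expr0 scale1r; apply/matrixP => i j.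
  by rewrite !mxE conjR -{1}As mxE.
have /orthomx_spectralP ACE := hermitian_normalmx ACs.
have Pu := spectral_unitarymx AC.
move: ACE (hermitian_spectral_diag_real ACs) Pu.
set P := spectralmx AC; set D := spectral_diag AC => ACE Dr Pu.
have Pinv := unitarymx_unit Pu.
pose D' : 'rV[R]_p.+1 := \row_i Re (D 0 i).
have DE : D = map_mx toC D'.
  apply/rowP => i; rewrite !mxE.
  by rewrite /= RRe_real//; exact: (mxOverP Dr).
have PA : P *m AC *m P^t* = diag_mx D.
  by rewrite {1}ACE -invmx_unitary// !mulmxA mulmxV// mul1mx mulmxK.
(* An eigenvalue is the Hermitian form of [A] at a row of [P]. As [A] is real, the real part of that
   form is the sum of the real forms at the real and imaginary parts of the row. *)
have D'0 i : 0 <= D' 0 i.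
  pose x : 'cV[R]_p.+1 := \col_j Re (P i j).
  pose y : 'cV[R]_p.+1 := \col_j Im (P i j).
  have -> : D' 0 i = (x^T *m A *m x) 0 0 + (y^T *m A *m y) 0 0; last first.
    by rewrite addr_ge0.
  have := congr1 (fun M : 'M[C]_p.+1 => Re (M i i)) PA.
  rewrite /= [in RHS]mxE eqxx mulr1n [RHS](_ : _ = D' 0 i) ?mxE// => <-.
  have ReD (u v : C) : Re (u + v) = Re u + Re v by case: u v => ? ? [].
  have Re0 : Re (0 : C) = 0 by [].
  rewrite (big_morph _ ReD Re0) -big_split/=; apply: eq_bigr => j _.
  rewrite !mxE !mulr_suml (big_morph _ ReD Re0) -big_split/=.
  apply: eq_bigr => k _; rewrite !mxE.
  case: (P i k) => a b; case: (P i j) => c e; rewrite /= /Num.conj/=.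
  simpc => /=; ring.
clearbody D'.
have [r rP] := interpolation (fun x => Num.sqrt (Num.sqrt x))
  [seq D' 0 i | i <- enum 'I_p.+1].
pose B := horner_mx A r.
have Bs : B^T = B.
  rewrite /B; elim/poly_ind: r {rP B} => [|r c IH].
    by rewrite raddf0 trmx0.
  rewrite rmorphD rmorphM/= horner_mx_X horner_mx_C.
  rewrite [LHS]linearD/= tr_scalar_mx trmx_mul As IH; congr (_ + _).
  exact/esym/comm_horner_mx.
have B4 : B *m B *m (B *m B) = A.
  have -> : B *m B *m (B *m B) = horner_mx A (r ^+ 4).
    by rewrite rmorphXn/= !mulmxE -!expr2 -exprM.
  (* Over the complex numbers [A] is diagonal in the basis [P], and r^4 fixes each eigenvalue
     because r takes its fourth root there. *)
  apply: (@map_mx_inj _ _ toC _ _); rewrite map_horner_mx -/AC ACE.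
  rewrite (horner_mx_uconjC _ _ Pinv) horner_mx_diag DE.
  rewrite [X in diag_mx X](_ : _ = map_mx toC D').
    reflexivity.
  apply/rowP => i; rewrite [LHS]mxE [in LHS]mxE [RHS]mxE.
  rewrite horner_map/= horner_exp rP; last by rewrite map_f ?mem_enum.
  by rewrite -[X in _ ^+ X](@mulnn 2) exprM !sqr_sqrtr ?sqrtr_ge0.
(* Since [B] is symmetric, the form of [B *m B] at x is the squared length of B x; no sign of the
   eigenvalues of [B] is needed. *)
exists (B *m B); split=> //; split; first by rewrite trmx_mul Bs.
move=> x; rewrite -{1}Bs mulmxA -trmx_mul -mulmxA mxE sumr_ge0// => i _.
by rewrite mxE -expr2 sqr_ge0.
Qed.

End SquareRoot.

End SquareRoot.

Section Forms.
Variable R : realType.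

Lemma sqrtmxP p (A : 'M[R]_p) : psdmx A ->
  psdmx (sqrtmx A) /\ sqrtmx A *m sqrtmx A = A.
Proof.
by move=> /psdmx_sqrt exS; rewrite /sqrtmx; exact: (@xgetPex _ 0 _ exS).
Qed.

Lemma weightmx_psd p (f : 'I_p -> R -> R) :
  (forall i, is_pdf (f i)) -> psdmx (weightmx f).
Proof.
move=> hf; rewrite /weightmx; set a := \col_i _; split=> [|x].
  by rewrite linearD/= tr_diag_mx trmx_mul trmxK.
rewrite mulmxDr mulmxDl mxE addr_ge0//.
  rewrite mxE sumr_ge0// => i _; rewrite mul_mx_diag !mxE mulrAC -expr2.
  rewrite mulr_ge0 ?sqr_ge0// /pdf_var Rintegral_ge0// => t _.
  by have [_ f0 _] := hf i; rewrite mulr_ge0 ?sqr_ge0.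
rewrite mulmxA -mulmxA mxE big_ord1.
have -> : x^T *m a = (a^T *m x)^T by rewrite trmx_mul trmxK.
by rewrite [in X in X * _]mxE -expr2 sqr_ge0.
Qed.

Variables (p : nat) (W : 'M[R]_p).

(** The semi-inner product of [W]. All the estimators depend on the data only through its values,
    that is, through Gram matrices. *)
Definition form (u v : 'cV[R]_p) : R := (u^T *m W *m v) 0 0.

Lemma formBl u v w : form (u - v) w = form u w - form v w.
Proof. by rewrite /form linearB/= !mulmxBl !mxE. Qed.

Lemma formBr u v w : form u (v - w) = form u v - form u w.
Proof. by rewrite /form mulmxBr !mxE. Qed.

Lemma formZl k u v : form (k *: u) v = k * form u v.
Proof. by rewrite /form linearZ/= -!scalemxAl mxE. Qed.

Lemma formZr k u v : form u (k *: v) = k * form u v.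
Proof. by rewrite /form -scalemxAr mxE. Qed.

Lemma form_suml I (r : seq I) (P : pred I) (F : I -> 'cV[R]_p) v :
  form (\sum_(i <- r | P i) F i) v = \sum_(i <- r | P i) form (F i) v.
Proof. by rewrite /form linear_sum !mulmx_suml summxE. Qed.

Lemma form_sumr I (r : seq I) (P : pred I) (F : I -> 'cV[R]_p) v :
  form v (\sum_(i <- r | P i) F i) = \sum_(i <- r | P i) form v (F i).
Proof. by rewrite /form mulmx_sumr summxE. Qed.

Hypothesis Wpsd : psdmx W.

Lemma formC u v : form u v = form v u.
Proof.
have [Ws _] := Wpsd.
rewrite /form; have -> : u^T *m W *m v = (v^T *m W *m u)^T.
  by rewrite !trmx_mul trmxK Ws mulmxA.
by rewrite mxE.
Qed.

Lemma norm2_sqrtmx v : norm2 (sqrtmx W *m v) ^+ 4 = form v v ^+ 2.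
Proof.
have [[Ss _] SS] := sqrtmxP Wpsd.
rewrite -[4%N]/(2 * 2)%N exprM; congr (_ ^+ 2).
rewrite /norm2 sqr_sqrtr; last by apply: sumr_ge0 => i _; exact: sqr_ge0.
have -> : form v v = ((sqrtmx W *m v)^T *m (sqrtmx W *m v)) 0 0.
  by rewrite /form -[in LHS]SS trmx_mul Ss !mulmxA.
by rewrite mxE; apply: eq_bigr => i _; rewrite [in RHS]mxE expr2.
Qed.

End Forms.

Section SampleCovariance.
Variables (R : realType) (p : nat) (W : 'M[R]_p).
Hypothesis Wpsd : psdmx W.
Local Notation form := (form W).

Lemma mxtrace_rank1 (u v : 'cV[R]_p) :
  \tr (W *m (u *m u^T) *m W *m (v *m v^T)) = form u v ^+ 2.
Proof.
have -> : W *m (u *m u^T) *m W *m (v *m v^T) = (W *m u) *m (u^T *m W *m v *m v^T).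
  by rewrite !mulmxA.
rewrite mxtrace_mulC -[X in \tr X]mulmxA [v^T *m _]mulmxA.
by rewrite trace_mx11 mxE big_ord1 expr2 -!/(form _ _) [form v u]formC.
Qed.

Lemma mxtrace_cov N N' (y : 'I_N -> 'cV[R]_p) (y' : 'I_N' -> 'cV[R]_p) :
  \tr (W *m sample_cov y *m W *m sample_cov y') =
  (N%:R - 1)^-1 * (N'%:R - 1)^-1 * \sum_i \sum_j
    form (y i - sample_mean y) (y' j - sample_mean y') ^+ 2.
Proof.
rewrite /sample_cov -!scalemxAr -!scalemxAl scalerA mxtraceZ [X in X * _]mulrC.
congr (_ * _).
rewrite mulmx_sumr raddf_sum [RHS]exchange_big/=; apply: eq_bigr => j _.
rewrite mulmx_sumr !mulmx_suml raddf_sum/=; apply: eq_bigr => i _.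
exact: mxtrace_rank1.
Qed.

Lemma mxtrace_cov1 N (y : 'I_N -> 'cV[R]_p) :
  \tr (W *m sample_cov y) =
  (N%:R - 1)^-1 * \sum_i form (y i - sample_mean y) (y i - sample_mean y).
Proof.
rewrite /sample_cov -!scalemxAr mxtraceZ; congr (_ * _).
rewrite mulmx_sumr raddf_sum/=; apply: eq_bigr => i _.
by rewrite mulmxA mxtrace_mulC mulmxA trace_mx11.
Qed.

(** Centring is invariant under translation, so the sample mean may be taken of the observations
    minus their true mean, which are linear in the standardized vectors. *)
Lemma centered_translation N (y : 'I_N -> 'cV[R]_p) mu i : (0 < N)%N ->
  y i - sample_mean y = (y i - mu) - N%:R^-1 *: \sum_j (y j - mu).
Proof.
move=> N0; rewrite sumrB sumr_const card_ord scalerBr -[mu *+ N]scaler_nat scalerA.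
rewrite mulVf ?pnatr_eq0 -?lt0n// scale1r /sample_mean.
by rewrite opprB addrA subrK.
Qed.

(** The right-hand side is left nested, centred along one index and then along the other, so that
    the one-dimensional identity [sum_sqr_centered] applies once per direction. *)
Lemma form_centered N N' (y : 'I_N -> 'cV[R]_p) (y' : 'I_N' -> 'cV[R]_p)
    mu mu' i j : (0 < N)%N -> (0 < N')%N ->
  let a k l := form (y k - mu) (y' l - mu') in
  form (y i - sample_mean y) (y' j - sample_mean y') =
  (a i j - N%:R^-1 * \sum_k a k j)
  - N'%:R^-1 * (\sum_l (a i l - N%:R^-1 * \sum_k a k l)).
Proof.
move=> N0 N'0 a; rewrite (centered_translation _ mu)// (centered_translation _ mu')//.
have formE u v u' v' k k' : form (u - k *: v) (u' - k' *: v') =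
    form u u' - k * form v u' - k' * (form u v' - k * form v v').
  by rewrite formBl !formBr !formZl !formZr; ring.
rewrite formE [form (y i - mu) (\sum_j _)]form_sumr.
rewrite [form (\sum_j _) (y' j - mu')]form_suml.
have -> : form (\sum_j (y j - mu)) (\sum_j (y' j - mu')) =
    \sum_l \sum_k a k l.
  rewrite form_suml exchange_big/=; apply: eq_bigr => k _.
  by rewrite form_sumr.
rewrite sumrB -mulr_sumr /a; ring.
Qed.

End SampleCovariance.

Section Centering.
Variable R : realType.

Lemma sum_sqr_centered n (f : 'I_n -> R) : (0 < n)%N ->
  \sum_i (f i - n%:R^-1 * \sum_j f j) ^+ 2 =
  \sum_i f i ^+ 2 - n%:R^-1 * (\sum_j f j) ^+ 2.
Proof.
move=> n0; set s := \sum_j f j.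
set c := _ * s.
have E i : (f i - c) ^+ 2 = f i ^+ 2 - 2 * c * f i + c ^+ 2 by ring.
under eq_bigr do rewrite E.
rewrite big_split sumrB/= sumr_const card_ord -mulr_sumr -/s -[_ *+ n]mulr_natr.
rewrite /c {c E}.
have : n%:R != 0 :> R by rewrite pnatr_eq0 -lt0n.
move: (\sum_i f i ^+ 2) (n%:R : R) => q x x0; by field.
Qed.

(** The two-way analysis of variance identity: [sum_sqr_centered] is used in one direction, the sums
    are exchanged, and it is used in the other. *)
Lemma sum_sqr_doubly_centered N N' (a : 'I_N -> 'I_N' -> R) :
  (0 < N)%N -> (0 < N')%N ->
  \sum_i \sum_j ((a i j - N%:R^-1 * \sum_k a k j)
     - N'%:R^-1 * (\sum_l (a i l - N%:R^-1 * \sum_k a k l))) ^+ 2 =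
  \sum_i \sum_j a i j ^+ 2 - N'%:R^-1 * \sum_i (\sum_j a i j) ^+ 2
  - N%:R^-1 * \sum_j (\sum_i a i j) ^+ 2
  + N%:R^-1 * N'%:R^-1 * (\sum_i \sum_j a i j) ^+ 2.
Proof.
move=> N0 N'0; under eq_bigr do rewrite sum_sqr_centered//.
rewrite sumrB exchange_big/=; under eq_bigr do rewrite sum_sqr_centered//.
rewrite sumrB -!mulr_sumr.
have -> : \sum_j \sum_i a i j ^+ 2 = \sum_i \sum_j a i j ^+ 2.
  by rewrite exchange_big.
under [X in _ - _ * X = _]eq_bigr do rewrite sumrB -mulr_sumr exchange_big/=.
rewrite sum_sqr_centered//; ring.
Qed.

(* The diagonal of the Gram matrix a cancels. *)
Lemma trsq_algebra n (a : 'I_n -> 'I_n -> R) :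
  (3 < n)%N -> (forall i j, a i j = a j i) ->
  let b i j := (a i j - n%:R^-1 * \sum_k a k j)
     - n%:R^-1 * (\sum_l (a i l - n%:R^-1 * \sum_k a k l)) in
  let c i j := if i == j then 0 else a i j in
  let x : R := n%:R in
  (x - 1) / (x * (x - 2) * (x - 3)) *
    ((x - 1) * (x - 2) * ((x - 1)^-1 * (x - 1)^-1 * \sum_i \sum_j b i j ^+ 2)
     + ((x - 1)^-1 * \sum_i b i i) ^+ 2
     - x * ((x - 1)^-1 * \sum_i b i i ^+ 2)) =
  ((x - 2) * \sum_i \sum_j c i j ^+ 2 - 2 * \sum_i (\sum_j c i j) ^+ 2
    + (x - 1)^-1 * (\sum_i \sum_j c i j) ^+ 2) / (x * (x - 2) * (x - 3)).
Proof.
move=> n3 aC b c x.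
have [x0 x1 x2 x3] : [/\ x != 0, x - 1 != 0, x - 2 != 0 & x - 3 != 0].
  rewrite /x !subr_eq0 !eqr_nat pnatr_eq0 -[1]/(1%:R) eqr_nat.
  by case: n n3 {a aC b c x} => [|[|[|[|]]]].
pose e i := a i i.
pose r i := \sum_j c i j.
have rowE i : \sum_j a i j = r i + e i.
  rewrite /r (bigD1 i)//= [in RHS](bigD1 i)//= /c eqxx add0r addrC /e.
  by congr (_ + _); apply: eq_bigr => j; rewrite eq_sym => /negbTE ->.
have colE j : \sum_i a i j = r j + e j.
  by rewrite -rowE; apply: eq_bigr => i _; rewrite aC.
have row2E i : \sum_j a i j ^+ 2 = \sum_j c i j ^+ 2 + e i ^+ 2.
  rewrite (bigD1 i)//= [in RHS](bigD1 i)//= /c eqxx expr0n add0r addrC /e.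
  by congr (_ + _); apply: eq_bigr => j; rewrite eq_sym => /negbTE ->.
pose S := \sum_i r i + \sum_i e i.
have tE : \sum_i \sum_j a i j = S.
  by under eq_bigr do rewrite rowE; rewrite big_split.
have bE i : b i i = (1 - 2 * x^-1) * e i - 2 * x^-1 * r i + x^-1 ^+ 2 * S.
  rewrite /b colE sumrB -mulr_sumr rowE exchange_big tE -/(e i) /x; ring.
(* Both sides become expressions in these six sums and [x]. Those that involve the diagonal [e],
   namely [Sre], [See] and [Se], cancel in the final [field]. *)
pose S2 := \sum_i \sum_j c i j ^+ 2.
pose Srr := \sum_i r i ^+ 2; pose Sre := \sum_i r i * e i.
pose See := \sum_i e i ^+ 2; pose Sr := \sum_i r i; pose Se := \sum_i e i.
have SE : S = Sr + Se by [].
clearbody S.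
have a2E : \sum_i \sum_j a i j ^+ 2 = S2 + See.
  by under eq_bigr do rewrite row2E; rewrite big_split.
have rE : \sum_i (\sum_j a i j) ^+ 2 = Srr + 2 * Sre + See.
  have E i : (\sum_j a i j) ^+ 2 = r i ^+ 2 + 2 * (r i * e i) + e i ^+ 2.
    by rewrite rowE; ring.
  by under eq_bigr do rewrite E; rewrite !big_split/= -mulr_sumr.
have cE : \sum_j (\sum_i a i j) ^+ 2 = Srr + 2 * Sre + See.
  by rewrite -rE; apply: eq_bigr => j _; rewrite colE rowE.
have bbE : \sum_i b i i = (1 - 2 * x^-1) * Se - 2 * x^-1 * Sr + x^-1 * S.
  under eq_bigr do rewrite bE.
  rewrite big_split sumrB/= -!mulr_sumr sumr_const card_ord -[_ *+ n]mulr_natr.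
  rewrite -/x -/Sr -/Se -?/Srr -?/Sre -?/See.
  by field.
have b2E : \sum_i b i i ^+ 2 = (1 - 2 * x^-1) ^+ 2 * See
   - 4 * x^-1 * (1 - 2 * x^-1) * Sre + 4 * x^-1 ^+ 2 * Srr
   + 2 * x^-1 ^+ 2 * S * ((1 - 2 * x^-1) * Se - 2 * x^-1 * Sr)
   + x^-1 ^+ 3 * S ^+ 2.
  have E i : b i i ^+ 2 = (1 - 2 * x^-1) ^+ 2 * e i ^+ 2
   - 4 * x^-1 * (1 - 2 * x^-1) * (r i * e i) + 4 * x^-1 ^+ 2 * r i ^+ 2
   + 2 * x^-1 ^+ 2 * S * ((1 - 2 * x^-1) * e i - 2 * x^-1 * r i)
   + x^-1 ^+ 4 * S ^+ 2.
    by rewrite bE; ring.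
  under eq_bigr do rewrite E.
  rewrite !big_split/= !sumrN -!mulr_sumr !big_split/= !sumrN -!mulr_sumr.
  rewrite sumr_const card_ord -[_ *+ n]mulr_natr.
  rewrite -/x -/Sr -/Se -?/Srr -?/Sre -?/See.
  by field.
rewrite [\sum_i \sum_j b i j ^+ 2]sum_sqr_doubly_centered ?(ltn_trans _ n3)//.
rewrite tE a2E rE cE bbE b2E -/S2.
have -> : \sum_i \sum_j c i j = Sr by [].
have -> : \sum_i (\sum_j c i j) ^+ 2 = Srr by [].
rewrite SE -/x; field; by rewrite x0 x1 x2 x3.
Qed.

End Centering.

Section Estimates.
Variables (R : realType) (p : nat) (W : 'M[R]_p).
Hypothesis Wpsd : psdmx W.
Local Notation form := (form W).

Lemma trsq_estE N (y : 'I_N -> 'cV[R]_p) mu : (3 < N)%N ->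
  let c i j := if i == j then 0 else form (y i - mu) (y j - mu) in
  trsq_est W y =
  ((N%:R - 2) * \sum_i \sum_j c i j ^+ 2 - 2 * \sum_i (\sum_j c i j) ^+ 2
    + (N%:R - 1)^-1 * (\sum_i \sum_j c i j) ^+ 2)
  / (N%:R * (N%:R - 2) * (N%:R - 3)).
Proof.
move=> N3 c; have N0 : (0 < N)%N by exact: ltn_trans N3.
rewrite -trsq_algebra// => [|i j]; last exact: formC.
rewrite /trsq_est mulmxA mxtrace_cov// mxtrace_cov1.
rewrite /Qstat; congr (_ * (_ * (_ * _) + (_ * _) ^+ 2 - _ * (_ * _))).
- apply: eq_bigr => i _; apply: eq_bigr => j _.
  by rewrite (form_centered _ _ _ mu mu).
- by apply: eq_bigr => i _; rewrite (form_centered _ _ _ mu mu).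
- by apply: eq_bigr => i _; rewrite norm2_sqrtmx// (form_centered _ _ _ mu mu).
Qed.

Lemma mxtrace_covE N N' (y : 'I_N -> 'cV[R]_p) (y' : 'I_N' -> 'cV[R]_p) mu mu' :
  (0 < N)%N -> (0 < N')%N ->
  let c i j := form (y i - mu) (y' j - mu') in
  \tr (W *m sample_cov y *m W *m sample_cov y') =
  (N%:R - 1)^-1 * (N'%:R - 1)^-1 *
  (\sum_i \sum_j c i j ^+ 2 - N'%:R^-1 * \sum_i (\sum_j c i j) ^+ 2
   - N%:R^-1 * \sum_j (\sum_i c i j) ^+ 2
   + N%:R^-1 * N'%:R^-1 * (\sum_i \sum_j c i j) ^+ 2).
Proof.
move=> N0 N'0 c; rewrite mxtrace_cov// -sum_sqr_doubly_centered//.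
congr (_ * _); apply: eq_bigr => i _; apply: eq_bigr => j _.
by rewrite (form_centered _ _ _ mu mu').
Qed.

Lemma mxtrace_WSigma m (G G' : 'M[R]_(p, m)) :
  \tr (W *m (G *m G^T) *m W *m (G' *m G'^T)) =
  \sum_s \sum_t (G^T *m W *m G') s t ^+ 2.
Proof.
have -> : W *m (G *m G^T) *m W *m (G' *m G'^T) =
    (W *m G) *m (G^T *m W *m G' *m G'^T) by rewrite !mulmxA.
rewrite mxtrace_mulC -[X in \tr X]mulmxA.
have -> : G'^T *m (W *m G) = (G^T *m W *m G')^T.
  by have [Ws _] := Wpsd; rewrite !trmx_mul trmxK Ws mulmxA.
rewrite /mxtrace; apply: eq_bigr => s _; rewrite mxE.
by apply: eq_bigr => t _; rewrite [X in _ * X]mxE expr2.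
Qed.

Lemma form_mulmx m (G G' : 'M[R]_(p, m)) (z z' : 'cV[R]_m) :
  form (G *m z) (G' *m z') =
  \sum_s z s 0 * \sum_t (G^T *m W *m G') s t * z' t 0.
Proof.
rewrite /form; have -> : (G *m z)^T *m W *m (G' *m z') =
    z^T *m (G^T *m W *m G' *m z') by rewrite trmx_mul !mulmxA.
by rewrite mxE; apply: eq_bigr => s _; rewrite !mxE.
Qed.

End Estimates.

(** This makes the denominator of the variance ratio positive. A diagonal coefficient is the squared
    length of a column of [contrast_mx]; if all vanished, the contrast matrix would be 0, and
    multiplying by the invertible square root would give [Gt = 0]. *)
Lemma contrast_coef_neq0 (R : realType) K q (Gt : 'M[R]_(q, K))
    (N : 'I_K -> nat) : (0 < q)%N -> \rank Gt = q ->
  (forall alpha, 0 < N alpha)%N ->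
  exists alpha, contrast_coef Gt N alpha alpha != 0.
Proof.
move=> q0 rG N0.
set A := Gt *m ratio_mx N *m Gt^T.
have wgt0 alpha : 0 < ((\sum_beta N beta)%N%:R / (N alpha)%:R : R).
  rewrite divr_gt0 ?ltr0n// (leq_trans (N0 alpha))//.
  by rewrite (bigD1 alpha)//= leq_addr.
have quadE (x : 'cV[R]_q) : (x^T *m A *m x) 0 0 =
    \sum_alpha (\sum_beta N beta)%N%:R / (N alpha)%:R * (Gt^T *m x) alpha 0 ^+ 2.
  have -> : x^T *m A *m x = ((Gt^T *m x)^T *m ratio_mx N) *m (Gt^T *m x).
    by rewrite trmx_mul trmxK /A !mulmxA.
  rewrite mxE; apply: eq_bigr => alpha _.
  by rewrite /ratio_mx mul_mx_diag !mxE; ring.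
have Apsd : psdmx A.
  split=> [|x]; first by rewrite /A !trmx_mul trmxK tr_diag_mx mulmxA.
  rewrite quadE sumr_ge0// => alpha _.
  by rewrite mulr_ge0 ?sqr_ge0// ltW.
(* The weights are positive, so a kernel vector of [A] is annihilated by [Gt^T]; full row rank then
   makes it zero. *)
have Aunit : A \in unitmx.
  rewrite -row_free_unit -kermx_eq0; apply/rowV0P => v /sub_kermxP vA.
  have : (v^T^T *m A *m v^T) 0 0 = 0 by rewrite trmxK vA mul0mx mxE.
  rewrite quadE => /psumr_eq0P H.
  have vG : Gt^T *m v^T = 0.
    apply/matrixP => alpha i; rewrite ord1 [RHS]mxE.
    have /eqP := H (fun alpha _ => mulr_ge0 (ltW (wgt0 alpha)) (sqr_ge0 _)) alpha isT.
    by rewrite mulf_eq0 gt_eqF//= sqrf_eq0 => /eqP.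
  have : row_free Gt by rewrite /row_free rG.
  move=> /row_free_inj; apply; rewrite mul0mx.
  by apply: trmx_inj; rewrite trmx_mul vG trmx0.
have [_ SS] := sqrtmxP Apsd.
have Sunit : sqrtmx A \in unitmx.
  by move: Aunit; rewrite -[X in X \in _]SS unitmx_mul => /andP[].
apply: contrapT => /forallNP Z.
have G0 : contrast_mx Gt N = 0.
  apply/matrixP => i alpha; rewrite [RHS]mxE.
  have /negP/negPn/eqP := Z alpha; rewrite /contrast_coef mxE.
  move=> /psumr_eq0P H; apply/eqP.
  have := H _ i isT; rewrite !mxE -expr2 => /(_ _)/eqP; rewrite sqrf_eq0; apply.
  by move=> j _; rewrite !mxE -expr2 sqr_ge0.
have Gt0 : Gt = 0.
  by rewrite -(mulKVmx Sunit Gt) -[invmx _ *m _]/(contrast_mx Gt N) G0 mulmx0.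
by move: q0; rewrite -rG Gt0 mxrank0.
Qed.

(** * Independence *)

Section Independence.
Context {R : realType} d (T : measurableType d) (P : probability T R)
  d' (T' : measurableType d').

Import HBNNSimple.

Let indicE_fsum (h : {nnsfun T' >-> R}) (Z : T -> T') w :
  (h (Z w))%:E = (\sum_(y \in range h) y%:E * (\1_(h @^-1` [set y]) (Z w))%:E)%E.
Proof. by rewrite fsumEFin// fimfunE. Qed.

(** A simple function is a finite combination of indicators of its level sets, and both sides are
    linear in it. Nonnegativity spares all integrability conditions. *)
Lemma ge0_integral_indep_nnsfun (g : T -> R) (Z : {RV P >-> T'}) (c : R)
    (h : {nnsfun T' >-> R}) :
  measurable_fun [set: T] g -> (forall w, 0 <= g w) ->
  (forall A, measurable A ->
     (\int[P]_w (g w * \1_A (Z w))%:E = c%:E * P (Z @^-1` A))%E) ->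
  (\int[P]_w (g w * h (Z w))%:E = c%:E * \int[P]_w (h (Z w))%:E)%E.
Proof.
move=> mg g0 H.
have mI y : measurable_fun [set: T] (fun w => \1_(h @^-1` [set y]) (Z w) : R).
  by apply: measurableT_comp.
have mgI y : measurable_fun [set: T]
    (fun w => (g w * \1_(h @^-1` [set y]) (Z w))%:E).
  by apply/measurable_EFinP; exact: measurable_funM.
have gI0 y w : (0 <= (g w * \1_(h @^-1` [set y]) (Z w))%:E)%E.
  by rewrite lee_fin mulr_ge0.
have ygI0 y w : (0 <= y%:E * (g w * \1_(h @^-1` [set y]) (Z w))%:E)%E.
  have [y0|y0] := leP 0 y; first by rewrite mule_ge0.
  (* A negative level has an empty level set. *)
  by rewrite preimage_nnfun0// indicE in_set0 mulr0 mule0.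
have -> : (\int[P]_w (g w * h (Z w))%:E =
    \int[P]_w \sum_(y \in range h)
      y%:E * (g w * \1_(h @^-1` [set y]) (Z w))%:E)%E.
  apply: eq_integral => w _; rewrite EFinM indicE_fsum ge0_mule_fsumr.
    by apply: eq_fsbigr => y _; rewrite EFinM muleCA.
  by move=> y; exact: nnfun_muleindic_ge0.
rewrite ge0_integral_fsum//; last first.
  by move=> y; exact: measurable_funeM.
under [in RHS]eq_integral do rewrite indicE_fsum.
rewrite [in RHS]ge0_integral_fsum//; last 2 first.
  by move=> y; apply: measurable_funeM; exact/measurable_EFinP.
  by move=> y w _; exact: nnfun_muleindic_ge0.
rewrite ge0_mule_fsumr; last first.
  by move=> y; apply: integral_ge0 => w _; exact: nnfun_muleindic_ge0.
apply: eq_fsbigr => y; rewrite inE => -[z _ <-].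
rewrite !ge0_integralZl_EFin//; last exact/measurable_EFinP.
rewrite H; last exact: measurable_sfunP.
rewrite muleCA; congr (_ * (_ * _))%E.
rewrite -[X in P X](setIT) -integral_indic//.
by rewrite -[X in measurable X]setTI; apply: measurable_funP.
Qed.

(** Monotone convergence along simple functions increasing to [f]. The constant [c] is the integral
    of [g], as [A = setT] in the hypothesis shows. *)
Lemma ge0_integral_indep (g : T -> R) (Z : {RV P >-> T'}) (c : R)
    (f : T' -> R) :
  measurable_fun [set: T] g -> (forall w, 0 <= g w) ->
  (forall A, measurable A ->
     (\int[P]_w (g w * \1_A (Z w))%:E = c%:E * P (Z @^-1` A))%E) ->
  measurable_fun [set: T'] f -> (forall x, 0 <= f x) ->
  (\int[P]_w (g w * f (Z w))%:E = c%:E * \int[P]_w (f (Z w))%:E)%E.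
Proof.
move=> mg g0 H mf f0.
have mEf : measurable_fun [set: T'] (EFin \o f) by exact/measurable_EFinP.
pose h n := nnsfun_approx measurableT mEf n.
have hf x : (EFin \o h^~ x) @ \oo --> (f x)%:E.
  by apply: (cvg_nnsfun_approx measurableT mEf) => // y _; rewrite lee_fin.
have ndh x : {homo h^~ x : m n / (m <= n)%N >-> m <= n}.
  by move=> m n mn; have /lefP := nd_nnsfun_approx measurableT mEf mn; exact.
have mhZ n : measurable_fun [set: T] (fun w => h n (Z w)).
  by apply: measurableT_comp => //.
have lim_h : (fun n => \int[P]_w (h n (Z w))%:E)%E @ \oo -->
    (\int[P]_w (f (Z w))%:E)%E.
  rewrite [X in _ --> X](_ : _ = \int[P]_w limn (fun n => (h n (Z w))%:E))%E.
    apply: cvg_monotone_convergence => //.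
    - by move=> n; exact/measurable_EFinP.
    - by move=> n w _; rewrite lee_fin.
    - by move=> w _ m n mn; rewrite lee_fin ndh.
  by apply: eq_integral => w _; apply/esym/cvg_lim => //; exact: hf.
have lim_gh : (fun n => \int[P]_w (g w * h n (Z w))%:E)%E @ \oo -->
    (\int[P]_w (g w * f (Z w))%:E)%E.
  rewrite [X in _ --> X](_ : _ =
      \int[P]_w limn (fun n => (g w * h n (Z w))%:E))%E.
    apply: cvg_monotone_convergence => //.
    - by move=> n; apply/measurable_EFinP; exact: measurable_funM.
    - by move=> n w _; rewrite lee_fin mulr_ge0.
    - by move=> w _ m n mn; rewrite lee_fin ler_wpM2l ?ndh.
  apply: eq_integral => w _; apply/esym/cvg_lim => //.
  under eq_fun do rewrite EFinM.
  by rewrite EFinM; apply: cvgeZl => //; exact: hf.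
have : (fun n => \int[P]_w (g w * h n (Z w))%:E)%E @ \oo -->
    (c%:E * \int[P]_w (f (Z w))%:E)%E.
  under eq_fun do rewrite (ge0_integral_indep_nnsfun _ mg g0 H).
  exact: cvgeZl.
by move=> /cvg_lim <-//; apply/esym/cvg_lim.
Qed.

Variables (I : finType) (X : I -> {RV P >-> T'}).
Hypothesis X_iid : iid X.

Let L1 (Y : T -> R) := P.-integrable [set: T] (EFin \o Y).

Let L1_EX (Y : T -> R) : L1 Y -> (\int[P]_w (Y w)%:E = (\int[P]_w Y w)%:E)%E.
Proof. by move=> ?; rewrite /Rintegral fineK//; exact: integrable_fin_num. Qed.

Let mprod (F : I -> T' -> R) (Q : pred I) :
  (forall i, measurable_fun [set: T'] (F i)) ->
  measurable_fun [set: T] (fun w => \prod_(i | Q i) F i (X i w)).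
Proof.
move=> mF; under eq_fun do rewrite -big_filter.
by apply: measurable_prod => i _; exact: measurableT_comp.
Qed.

(* The factors are turned one at a time from indicators into arbitrary
   nonnegative functions. *)
Lemma ge0_integral_indep_prod (F : I -> T' -> R) :
  (forall i, measurable_fun [set: T'] (F i)) -> (forall i x, 0 <= F i x) ->
  (forall i, L1 (F i \o X i)) ->
  (\int[P]_w (\prod_i F i (X i w))%:E =
   (\prod_i \int[P]_w F i (X i w))%:E)%E.
Proof.
move=> mF F0 LF.
suff H (s : seq I) (G : I -> T' -> R) :
    (forall i, measurable_fun [set: T'] (G i)) -> (forall i x, 0 <= G i x) ->
    (forall i, L1 (G i \o X i)) ->
    (forall i, i \notin s -> exists2 A, measurable A & G i = \1_A) ->
    (\int[P]_w (\prod_i G i (X i w))%:E =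
     (\prod_i \int[P]_w G i (X i w))%:E)%E.
  apply: (H (enum I)) => // i; by rewrite mem_enum.
elim: s G => [|i s IH] G mG G0 LG GI.
  have /choice[A HA] : forall i, exists A, measurable A /\ G i = \1_A.
    by move=> i; have [//|A mA GA] := GI i; exists A.
  have GE i w : G i (X i w) = \1_(X i @^-1` A i) w.
    by have [_ ->] := HA i; rewrite !indicE.
  have mXA i : measurable (X i @^-1` A i).
    have [mA _] := HA i.
    by rewrite -[Y in measurable Y]setTI; apply: measurable_funP.
  have PE i : (\int[P]_w G i (X i w))%:E = P (X i @^-1` A i).
    rewrite -L1_EX; last exact: LG.
    by under eq_integral do rewrite GE; rewrite integral_indic// setIT.
  have [/(_ [set: I]%SET A) indep _] := X_iid.
  transitivity (P (\bigcap_(i in [set` [set: I]%SET]) (X i @^-1` A i))).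
    rewrite -[Y in P Y]setIT -integral_indic//; last first.
      by apply: fin_bigcap_measurable => //; exact: finite_finset.
    apply: eq_integral => w _; congr (_%:E).
    under eq_bigr do rewrite GE.
    rewrite [RHS]indicE; have [wA|/existsNP[i wA]] := pselect (forall i, A i (X i w)).
      rewrite mem_set => [|j _]; last exact: wA.
      by rewrite big1// => j _; rewrite indicE mem_set//; exact: wA.
    rewrite memNset => [|/(_ i)]; last by rewrite /= inE => /(_ isT).
    by rewrite [LHS](bigD1 i)//= indicE memNset// mul0r.
  rewrite indep; last by move=> j; have [] := HA j.
  rewrite (big_morph EFin EFinM (erefl _)).
  by apply: eq_big => [j|j _]; rewrite ?inE ?PE.
pose c := \prod_(j | j != i) \int[P]_w G j (X j w).
under eq_integral do rewrite (bigD1 i)//= mulrC.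
rewrite (ge0_integral_indep (Z := X i) (c := c)).
- by rewrite L1_EX; [rewrite (bigD1 i)//= EFinM muleC|exact: LG].
- exact: mprod.
- by move=> w; apply: prodr_ge0.
- move=> A mA.
  (* Replacing the i-th factor by an indicator gives a family to which the induction hypothesis for
     [s] applies; this supplies the hypothesis of [ge0_integral_indep]. *)
  pose G' j := if j == i then \1_A else G j.
  have G'E j : j != i -> G' j = G j by rewrite /G' => /negbTE ->.
  have G'i : G' i = \1_A by rewrite /G' eqxx.
  have mXA : measurable (X i @^-1` A).
    by rewrite -[Y in measurable Y]setTI; apply: measurable_funP.
  have LA : L1 (\1_A \o X i).
    by apply: (@integrable_indic _ _ _ P (X i @^-1` A)).
  have E1 w : \prod_j G' j (X j w) =
      (\prod_(j | j != i) G j (X j w)) * \1_A (X i w).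
    rewrite (bigD1 i)//= G'i mulrC; congr (_ * _).
    by apply: eq_bigr => j ji; rewrite G'E.
  have E2 : \prod_j \int[P]_w G' j (X j w) = c * \int[P]_w \1_A (X i w).
    rewrite (bigD1 i)//= G'i mulrC; congr (_ * _).
    by apply: eq_bigr => j ji; rewrite G'E.
  transitivity (\int[P]_w (\prod_j G' j (X j w))%:E)%E.
    by apply: eq_integral => w _; rewrite E1.
  rewrite IH.
  + rewrite E2 EFinM -L1_EX//; congr (_ * _)%E.
    by rewrite integral_indic// setIT.
  + by move=> j; rewrite /G'; case: eqP.
  + by move=> j x; rewrite /G'; case: eqP.
  + by move=> j; rewrite /G'; case: eqP => [->|].
  + move=> j js; have [->|ji] := eqVneq j i; first by exists A.
    by rewrite G'E//; apply: GI; rewrite inE negb_or ji.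
- exact: mG.
- exact: G0.
Qed.

(** The nonnegative case, applied to the absolute values, bounds the integral. *)
Lemma integrable_indep_prod (F : I -> T' -> R) :
  (forall i, measurable_fun [set: T'] (F i)) -> (forall i, L1 (F i \o X i)) ->
  L1 (fun w => \prod_i F i (X i w)).
Proof.
move=> mF LF; apply/integrableP; split; first exact/measurable_EFinP/mprod.
have -> : (\int[P]_w `|(\prod_i F i (X i w))%:E| =
    \int[P]_w (\prod_i `|F i (X i w)|)%:E)%E.
  by apply: eq_integral => w _; rewrite abse_EFin normr_prod.
rewrite (ge0_integral_indep_prod (F := fun i x => `|F i x|)) ?ltry//.
  by move=> i; exact: measurableT_comp.
by move=> i; exact: integrable_norm (LF i).
Qed.

(** Both sides are linear in each factor, so the factors are split one by one into positive and
    negative parts until all of them are nonnegative. *)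
Lemma Rintegral_indep_prod (F : I -> T' -> R) :
  (forall i, measurable_fun [set: T'] (F i)) -> (forall i, L1 (F i \o X i)) ->
  \int[P]_w (\prod_i F i (X i w)) = \prod_i \int[P]_w F i (X i w).
Proof.
move=> mF LF.
suff H (s : seq I) (G : I -> T' -> R) :
    (forall i, measurable_fun [set: T'] (G i)) -> (forall i, L1 (G i \o X i)) ->
    (forall i, i \notin s -> forall x, 0 <= G i x) ->
    \int[P]_w (\prod_i G i (X i w)) = \prod_i \int[P]_w G i (X i w).
  by apply: (H (enum I)) => // i; rewrite mem_enum.
elim: s G => [|i s IH] G mG LG G0.
  apply: EFin_inj; rewrite -ge0_integral_indep_prod// => [|i x].
    by rewrite L1_EX//; exact: integrable_indep_prod.
  exact: G0.
pose H (b : bool) j := if j == i then (if b then (G i)^\+ else (G i)^\-) else G j.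
have HE b j : j != i -> H b j = G j by rewrite /H => /negbTE ->.
have mH b j : measurable_fun [set: T'] (H b j).
  rewrite /H; case: eqP => // _; case: b; first exact: measurable_funrpos.
  exact: measurable_funrneg.
have LH b j : L1 (H b j \o X j).
  rewrite /H; case: eqP => // ->.
  case: b; first exact: (integrable_funrpos _ (LG i)).
  exact: (integrable_funrneg _ (LG i)).
have H0 b j : j \notin s -> forall x, 0 <= H b j x.
  move=> js x; rewrite /H; case: eqP => [|/eqP ji].
    by case: b => _; rewrite ?funrpos_ge0 ?funrneg_ge0.
  by apply: G0; rewrite inE negb_or ji.
have GE x : G i x = H true i x - H false i x.
  by rewrite /H eqxx -[in LHS](funrposBneg (G i)).
have D1 b w : \prod_j H b j (X j w) =
    H b i (X i w) * \prod_(j | j != i) G j (X j w).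
  rewrite (bigD1 i)//=; congr (_ * _).
  by apply: eq_bigr => j ji; rewrite HE.
have D1E b : \prod_j \int[P]_w H b j (X j w) =
    \int[P]_w H b i (X i w) * \prod_(j | j != i) \int[P]_w G j (X j w).
  rewrite (bigD1 i)//=; congr (_ * _).
  by apply: eq_bigr => j ji; rewrite HE.
transitivity (\int[P]_w (\prod_j H true j (X j w) - \prod_j H false j (X j w))).
  by apply: eq_Rintegral => w _; rewrite !D1 -mulrBl -GE (bigD1 i).
rewrite RintegralB//; [|exact: integrable_indep_prod..].
rewrite !(IH _ (mH _) (LH _) (H0 _)) !D1E -mulrBl [RHS](bigD1 i)//=; congr (_ * _).
rewrite -RintegralB//; [|exact: (LH true i)|exact: (LH false i)].
by apply: eq_Rintegral => w _; rewrite -GE.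
Qed.

End Independence.

(** * Moments of bilinear forms *)

Section Expectation.
Context {R : realType} d (T : measurableType d) (P : probability T R).
Local Notation L1 Y := (P.-integrable [set: T] (EFin \o Y)).

Lemma integrable_lin (J : finType) (h : J -> R) (Y : J -> T -> R) :
  (forall j, L1 (Y j)) -> L1 (fun w => \sum_j h j * Y j w).
Proof.
move=> LY.
have : P.-integrable [set: T] (fun w => \sum_(j <- index_enum J) (h j)%:E * (Y j w)%:E)%E.
  by apply: integrable_sum => // j _; exact: integrableZl (LY j).
by apply: eq_integrable => // w _ /=; rewrite -sumEFin.
Qed.

Lemma Rintegral_lin (J : finType) (h : J -> R) (Y : J -> T -> R) :
  (forall j, L1 (Y j)) ->
  \int[P]_w (\sum_j h j * Y j w) = \sum_j h j * \int[P]_w Y j w.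
Proof.
move=> LY; have LhY j : L1 (fun w => h j * Y j w).
  by have := @integrableZl _ _ _ P _ measurableT (h j) _ (LY j).
rewrite /Rintegral; under eq_integral do rewrite -sumEFin.
rewrite integral_sum//.
rewrite -[RHS]/(fine (_%:E)) -sumEFin; congr fine; apply: eq_bigr => j _.
rewrite -/(Rintegral _ _ _) -RintegralZl// /Rintegral fineK//.
exact: integrable_fin_num (LhY j).
Qed.

Lemma L1Z k Y : L1 Y -> L1 (fun w => k * Y w).
Proof. by move=> LY; exact: (@integrableZl _ _ _ P _ measurableT k _ LY). Qed.

Lemma L1D Y Z : L1 Y -> L1 Z -> L1 (fun w => Y w + Z w).
Proof. by move=> LY LZ; exact: (@integrableD _ _ _ P _ measurableT _ _ LY LZ). Qed.

Lemma L1B Y Z : L1 Y -> L1 Z -> L1 (fun w => Y w - Z w).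
Proof. by move=> LY LZ; exact: (@integrableB _ _ _ P _ measurableT _ _ LY LZ). Qed.

Lemma L1_cst k : L1 (fun=> k).
Proof. exact: finite_measure_integrable_cst. Qed.

Lemma L1_measurable Y : L1 Y -> measurable_fun [set: T] Y.
Proof. by case/integrableP => /measurable_EFinP. Qed.

Lemma L1_le (Y Z : T -> R) : measurable_fun [set: T] Y ->
  (forall w, `|Y w| <= Z w) -> L1 Z -> L1 Y.
Proof.
move=> mY YZ; apply: le_integrable => //; first exact/measurable_EFinP.
move=> w _ /=; rewrite lee_fin; apply: (le_trans (YZ w)); exact: ler_norm.
Qed.

Lemma expectationE Y : L1 Y -> ('E_P[Y] = (\int[P]_w Y w)%:E)%E.
Proof.
by move=> LY; rewrite unlock /Rintegral fineK//; exact: integrable_fin_num.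
Qed.

Lemma Rintegral_probability_cst k : Rintegral P [set: T] (fun=> k) = k.
Proof. by rewrite Rintegral_cst// [X in fine X]probability_setT mulr1. Qed.

End Expectation.

(** * Moments of degree at most four of a single vector *)

Section FourthMoments.
Context {R : realType} d (T : measurableType d) (P : probability T R).
Variables (m : nat) (Delta : R) (z : {RV P >-> m.-tuple R}).
Hypothesis z_std : standardized P z.
Hypothesis z_mom : moment_conditions P Delta z.
Local Notation L1 Y := (P.-integrable [set: T] (EFin \o Y)).

(** The list records indices with multiplicity: its size is the degree, and concatenation is
    multiplication. *)
Definition monomial (s : seq 'I_m) (x : m.-tuple R) : R := \prod_(k <- s) tnth x k.

Lemma monomial_perm s t : perm_eq s t -> monomial s =1 monomial t.
Proof. by move=> st x; exact: perm_big. Qed.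

Lemma monomialE s x : monomial s x = \prod_k tnth x k ^+ count_mem k s.
Proof.
rewrite /monomial; elim: s => [|a s IH]; first by rewrite big_nil big1.
rewrite big_cons IH [RHS](bigD1 a)//= eqxx add1n exprS -mulrA; congr (_ * _).
rewrite (bigD1 a)//=; congr (_ * _).
by apply: eq_bigr => k ka; rewrite eq_sym (negbTE ka).
Qed.

Lemma measurable_monomial s : measurable_fun [set: m.-tuple R] (monomial s).
Proof.
rewrite /monomial; apply: measurable_prod => k _.
exact: (@measurable_tnth _ (measurableTypeR R)).
Qed.

Let L1_pow4 k : L1 (fun w => component z k w ^+ 4).
Proof.
have [E4 _] := z_mom.
have mz : measurable_fun [set: T] (component z k).
  apply: (measurableT_comp (@measurable_tnth _ (measurableTypeR R) _ k)).
  exact: (@measurable_funPT _ _ _ _ z).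
apply/integrableP; split; first by apply/measurable_EFinP; exact: measurable_funX.
(* A fourth power is its own absolute value, so the identity in the extended reals says that its
   integral is finite. *)
rewrite (_ : integral _ _ _ = 'E_P[fun w => (component z k w ^+ 4)%R])%E.
  by rewrite E4 ltry.
rewrite unlock; apply: eq_integral => w _.
by rewrite /= ger0_norm// exprn_even_ge0.
Qed.

(** The dominating function N is 1 plus the sum of all fourth powers. Each coordinate has fourth
    power at most N, so the fourth power of the monomial is at most N to its degree; the summand 1
    gives N >= 1 and covers degrees below four. *)
Lemma integrable_monomial s : (size s <= 4)%N -> L1 (monomial s \o z).
Proof.
move=> s4; apply: (@L1_le _ _ _ _ _ (fun w => 1 + \sum_k 1 * component z k w ^+ 4)).
- by apply: measurableT_comp => //; exact: measurable_monomial.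
- move=> w /=; set N := 1 + _.
  have N1 : 1 <= N.
    by rewrite lerDl sumr_ge0// => k _; rewrite mul1r exprn_even_ge0.
  have N0 : 0 <= N by exact: le_trans N1.
  have zN k : `|tnth (z w) k| ^+ 4 <= N.
    rewrite /N (bigD1 k)//= mul1r -normrX ger0_norm ?exprn_even_ge0//.
    rewrite addrCA lerDl addr_ge0// sumr_ge0// => i _.
    by rewrite mul1r exprn_even_ge0.
  have H : `|monomial s (z w)| ^+ 4 <= N ^+ 4.
    rewrite (@le_trans _ _ (N ^+ size s))//; last exact: ler_weXn2l.
    rewrite /monomial normr_prod; elim: (s) => [|a t IH].
      by rewrite big_nil expr1n.
    by rewrite big_cons exprMn [leRHS]exprS ler_pM ?exprn_ge0// prodr_ge0.
  by rewrite -(@ler_pXn2r _ 4).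
- by apply: L1D; [exact: L1_cst|exact: integrable_lin].
Qed.

Let mu s := \int[P]_w monomial s (z w).

(** The assumption speaks of distinct indices with positive exponents. Enumerating the support [J]
    of [s] brings a monomial into that form; an index outside [J] contributes the expectation of
    1. *)
Lemma moment_factor s : (0 < size s <= 8)%N ->
  ('E_P[monomial s \o z] = \prod_k 'E_P[fun w => (component z k w ^+ count_mem k s)%R])%E.
Proof.
move=> /andP[s0 s8]; have [_ F] := z_mom.
pose J : {set 'I_m} := [set k | k \in s]%SET.
have cE k : k \notin J -> count_mem k s = 0%N.
  by rewrite inE => ks; apply/count_memPn.
have -> : monomial s \o z =
    (fun w => \prod_(j < #|J|) component z (enum_val j) w ^+ count_mem (enum_val j) s).
  apply/funext => w /=; rewrite monomialE.
  rewrite -(big_enum_val (fun k => component z k w ^+ count_mem k s))/=.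
  rewrite [LHS](bigID (mem J))/= [X in _ * X]big1 ?mulr1//.
  by move=> k kJ; rewrite cE.
rewrite F//.
- rewrite -(big_enum_val (fun k =>
    'E_P[fun w => (component z k w ^+ count_mem k s)%R]))%E/=.
  rewrite [RHS](bigID (mem J))/= [X in (_ * X)%E]big1 ?mule1//.
  move=> k kJ; rewrite cE// unlock; under eq_integral do rewrite expr0.
  by rewrite integral_cst// [X in (_ * X)%E]probability_setT mule1.
- case: s s0 {s8 cE} @J => // a s _ /=.
  by apply/card_gt0P; exists a; rewrite !inE eqxx.
- exact: enum_val_inj.
- by move=> j; have := enum_valP j; rewrite inE -has_pred1 has_count.
- rewrite (leq_trans _ s8)// -(big_enum_val (fun k => count_mem k s))/=.
  apply: (@leq_trans (\sum_k count_mem k s)).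
    by rewrite [leqRHS](bigID (mem J))/= leq_addr.
  elim: (s) => [|a t IH]; first by rewrite big1.
  rewrite /= big_split/= (bigD1 a)//= eqxx big1 ?addn0 ?ltnS// => k ka.
  by rewrite eq_sym (negbTE ka).
Qed.

(** An index that occurs once splits off the factor E z_a = 0. *)
Lemma mu_lone a s : a \notin s -> (size s <= 3)%N -> mu (a :: s) = 0.
Proof.
move=> aNs s3; apply: EFin_inj.
rewrite -expectationE; last exact: (@integrable_monomial (a :: s)).
rewrite moment_factor ?ltnS ?(leq_trans s3)// (bigD1 a)//= eqxx.
have /count_memPn -> : a \notin s by [].
have [E0 _] := z_std.
by under eq_fun do rewrite expr1; rewrite E0 mul0e.
Qed.

Let mu_perm s t : perm_eq s t -> mu s = mu t.
Proof. by move=> st; apply: eq_Rintegral => w _; exact: monomial_perm. Qed.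

Lemma moment2 a b : mu [:: a; b] = (a == b)%:R.
Proof.
have [E0 Ecov] := z_std.
apply: EFin_inj; rewrite -(expectationE (integrable_monomial (s := [:: a; b]) _))// -Ecov.
rewrite covariance.unlock !E0/=; congr expectation; apply/funext => w.
by rewrite /= /monomial !big_cons big_nil mulr1; congr (_ * _); rewrite /= subr0.
Qed.

Let moment_pairs a c : a != c -> mu [:: a; a; c; c] = 1.
Proof.
move=> ac; apply: EFin_inj.
rewrite -(expectationE (integrable_monomial (s := [:: a; a; c; c]) _))//.
have E2 k : ('E_P[fun w => (component z k w ^+ 2)%R] = 1)%E.
  rewrite -[1%E]/((1 : R)%:E) -[1 in RHS]/((true : nat)%:R) -[true](eqxx k) -moment2.
  rewrite -(expectationE (integrable_monomial (s := [:: k; k]) _))//.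
  congr expectation; apply/funext => w.
  by rewrite /monomial/= !big_cons big_nil mulr1.
rewrite moment_factor// (bigD1 a)//= (bigD1 c)/=; last by rewrite eq_sym.
rewrite !eqxx [c == a]eq_sym (negbTE ac) /= !E2 !mul1e big1// => k /andP[ka kc].
rewrite ![_ == k]eq_sym (negbTE ka) (negbTE kc)/= unlock.
under eq_integral do rewrite expr0.
by rewrite integral_cst// [X in (_ * X)%E]probability_setT mule1.
Qed.

Let moment_quad a : mu [:: a; a; a; a] = 3 + Delta.
Proof.
have [E4 _] := z_mom; apply: EFin_inj; rewrite -(E4 a).
rewrite -(expectationE (integrable_monomial (s := [:: a; a; a; a]) _))//.
congr expectation; apply/funext => w.
by rewrite /= /monomial !big_cons big_nil /component; ring.
Qed.

(** Isserlis' formula, corrected by the excess kurtosis [Delta] when all four indices agree. If the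
    indices do not match in pairs, some index is alone and, permuted to the front, gives zero by
    [mu_lone]. *)
Lemma moment4 a b c e : mu [:: a; b; c; e] =
  (a == b)%:R * (c == e)%:R + (a == c)%:R * (b == e)%:R
  + (a == e)%:R * (b == c)%:R + Delta * ((a == b) && (b == c) && (c == e))%:R.
Proof.
have lone (x y u v : 'I_m) : x != y -> x != u -> x != v -> mu [:: x; y; u; v] = 0.
  by move=> xy xu xv; rewrite mu_lone// !inE !negb_or xy xu xv.
have p4 (x y u v x' y' u' v' : 'I_m) : perm_eq [:: x; y; u; v] [:: x'; y'; u'; v'] ->
  mu [:: x; y; u; v] = mu [:: x'; y'; u'; v'] by exact: mu_perm.
have pb : mu [:: a; b; c; e] = mu [:: b; a; c; e].
  by apply: p4; apply/permP => p /=; lia.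
have pc : mu [:: a; b; c; e] = mu [:: c; a; b; e].
  by apply: p4; apply/permP => p /=; lia.
have pe : mu [:: a; b; c; e] = mu [:: e; a; b; c].
  by apply: p4; apply/permP => p /=; lia.
have pac : mu [:: a; b; c; e] = mu [:: a; c; b; e].
  by apply: p4; apply/permP => p /=; lia.
have pae : mu [:: a; b; c; e] = mu [:: a; e; b; c].
  by apply: p4; apply/permP => p /=; lia.
have [ab|ab] := eqVneq a b.
  have [ce|ce] := eqVneq c e.
    have [ac|ac] := eqVneq b c.
      by rewrite ab ac ce moment_quad !eqxx/=; ring.
    by rewrite ab ce moment_pairs -?ce// (negbTE ac)/=; ring.
  have ec : e != c by rewrite eq_sym.
  have [bc|bc] := eqVneq b c.
    by rewrite pe lone ?ab ?bc// ?eqxx (negbTE ce)/=; ring.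
  have cb : c != b by rewrite eq_sym.
  by rewrite pc lone ?ab//= (negbTE bc)/=; ring.
have ba : b != a by rewrite eq_sym.
have [ac|ac] := eqVneq a c.
  have [be|be] := eqVneq b e.
    by rewrite pac -ac -be moment_pairs// (negbTE ab)/=; ring.
  by rewrite pb lone -?ac//= (negbTE ba)/=; ring.
have [ae|ae] := eqVneq a e.
  have [bc|bc] := eqVneq b c.
    by rewrite pae -ae -bc moment_pairs//=; ring.
  by rewrite pb lone -?ae//=; ring.
by rewrite lone//=; ring.
Qed.

Lemma moment1 a : mu [:: a] = 0.
Proof. exact: mu_lone. Qed.

Lemma moment0 : mu [::] = 1.
Proof.
rewrite /mu; under eq_Rintegral do rewrite /monomial big_nil.
exact: Rintegral_probability_cst.
Qed.

End FourthMoments.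

(** * Index sums behind the fourth moment of a bilinear form *)

Section FourthOrderAlgebra.
Variables (R : realType) (m : nat) (Delta : R).
Local Notation I := 'I_m.
Local Notation J4 := (I * I * I * I)%type.

(* The moments E z_a z_b z_c z_e of a standardized vector z satisfying (A2). *)
Definition kappa (a b c e : I) : R :=
  (a == b)%:R * (c == e)%:R + (a == c)%:R * (b == e)%:R
  + (a == e)%:R * (b == c)%:R + Delta * ((a == b) && (b == c) && (c == e))%:R.

Lemma sum_delta (a : I) (g : I -> R) : \sum_b (a == b)%:R * g b = g a.
Proof.
rewrite (bigD1 a)//= eqxx mul1r big1 ?addr0// => b ba.
by rewrite eq_sym (negbTE ba) mul0r.
Qed.

Lemma prod4_sum (f1 f2 f3 f4 : I -> R) :
  (\sum_s f1 s) * (\sum_s f2 s) * (\sum_s f3 s) * (\sum_s f4 s) =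
  \sum_(s : J4) f1 s.1.1.1 * f2 s.1.1.2 * f3 s.1.2 * f4 s.2.
Proof. by do 3 rewrite big_distrlr pair_bigA. Qed.

(** Each of the three pairings imposes two equalities among four indices, leaving a double sum; the
    [Delta] term leaves a single one. *)
Lemma sum_kappa (f : J4 -> R) :
  \sum_(s : J4) kappa s.1.1.1 s.1.1.2 s.1.2 s.2 * f s =
  \sum_a \sum_b (f (a, a, b, b) + f (a, b, a, b) + f (a, b, b, a))
  + Delta * \sum_a f (a, a, a, a).
Proof.
have -> : \sum_(s : J4) kappa s.1.1.1 s.1.1.2 s.1.2 s.2 * f s =
    \sum_a \sum_b \sum_c \sum_e kappa a b c e * f (a, b, c, e).
  by rewrite !pair_bigA/=; apply: eq_bigr => -[[[]]].
rewrite mulr_sumr -big_split/=; apply: eq_bigr => a _.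
have E b c : \sum_e kappa a b c e * f (a, b, c, e) =
    (a == b)%:R * f (a, b, c, c) + (a == c)%:R * f (a, b, c, b)
    + (b == c)%:R * f (a, b, c, a)
    + Delta * ((a == b)%:R * ((b == c)%:R * f (a, b, c, c))).
  rewrite -(sum_delta c (fun e => f (a, b, c, e))).
  rewrite -(sum_delta b (fun e => f (a, b, c, e))).
  rewrite -(sum_delta a (fun e => f (a, b, c, e))).
  rewrite !mulr_sumr -!big_split/=; apply: eq_bigr => e _.
  by rewrite /kappa -!mulnb !natrM; ring.
under eq_bigr do under eq_bigr do rewrite E.
under eq_bigr do rewrite !big_split/= -!mulr_sumr.
rewrite !big_split/= -!mulr_sumr sum_delta.
under [X in _ + Delta * X]eq_bigr do rewrite sum_delta.
rewrite sum_delta; congr (_ + _ + _ + _).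
  by apply: eq_bigr => b _; rewrite (sum_delta a (fun c => f (a, b, c, b))).
by apply: eq_bigr => b _; rewrite (sum_delta b (fun c => f (a, b, c, a))).
Qed.

Lemma CauchySchwarz_sum (x y : I -> R) :
  (\sum_s x s * y s) ^+ 2 <= (\sum_s x s ^+ 2) * (\sum_s y s ^+ 2).
Proof.
(* Lagrange's identity: twice the difference is the double sum of (x_s y_t - x_t y_s)^2. Doubling
   allows one copy to be symmetrized. *)
rewrite expr2 !big_distrlr/= -subr_ge0 -(pmulr_rge0 _ (ltr0Sn _ 1)).
rewrite mulrBr mulr2n !mulrDl !mul1r.
rewrite [X in _ + X - _]exchange_big/= -!big_split/= -sumrB sumr_ge0// => s _.
rewrite -!big_split/= -sumrB sumr_ge0// => t _.
apply: le_trans (sqr_ge0 (x s * y t - x t * y s)) _.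
by rewrite le_eqVlt; apply/orP; left; apply/eqP; ring.
Qed.

Lemma sum_sqr_mul_le (x y : I -> R) :
  \sum_s x s ^+ 2 * y s ^+ 2 <= (\sum_s x s ^+ 2) * (\sum_s y s ^+ 2).
Proof.
rewrite mulr_suml; apply: ler_sum => s _; rewrite ler_wpM2l ?sqr_ge0//.
by rewrite (bigD1 s)//= lerDl sumr_ge0// => t _; exact: sqr_ge0.
Qed.

Variable M : 'M[R]_m.
Local Notation sq s := (\sum_t M s t ^+ 2).

(* By independence, E (x^T M y)^4 is the sum of kappa s * quad s over s. *)
Definition quad (s : J4) : R := \sum_(t : J4)
  kappa t.1.1.1 t.1.1.2 t.1.2 t.2 *
  (M s.1.1.1 t.1.1.1 * M s.1.1.2 t.1.1.2 * M s.1.2 t.1.2 * M s.2 t.2).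

Local Notation dot a b := (\sum_t M a t * M b t).

Lemma quadE a b c e : quad (a, b, c, e) =
  dot a b * dot c e + dot a c * dot b e + dot a e * dot b c
  + Delta * \sum_t M a t * M b t * M c t * M e t.
Proof.
rewrite /quad (sum_kappa (fun t => M a t.1.1.1 * M b t.1.1.2 * M c t.1.2 * M e t.2)).
rewrite /= !big_distrlr/= -!big_split/=; congr (_ + _).
apply: eq_bigr => s _; rewrite -!big_split/=; apply: eq_bigr => t _; ring.
Qed.

(** One pairing gives [sq a * sq b], the two others give a squared inner product, bounded by
    Cauchy-Schwarz; hence the 3. The [Delta] term is bounded by [sum_sqr_mul_le]. *)
Lemma quad_le a b : `|quad (a, a, b, b)| <= (3 + `|Delta|) * (sq a * sq b).
Proof.
have dotC : dot b a = dot a b by apply: eq_bigr => t _; rewrite mulrC.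
have dotE s : dot s s = sq s by apply: eq_bigr => t _; rewrite expr2.
have sq0 s : 0 <= sq s by apply: sumr_ge0 => t _; exact: sqr_ge0.
rewrite quadE !dotE.
have -> : \sum_t M a t * M a t * M b t * M b t = \sum_t M a t ^+ 2 * M b t ^+ 2.
  by apply: eq_bigr => t _; ring.
have := CauchySchwarz_sum (M a) (M b); have := sum_sqr_mul_le (M a) (M b).
have : 0 <= \sum_t M a t ^+ 2 * M b t ^+ 2.
  by apply: sumr_ge0 => t _; rewrite mulr_ge0 ?sqr_ge0.
have : 0 <= dot a b ^+ 2 by exact: sqr_ge0.
have := mulr_ge0 (sq0 a) (sq0 b).
move: (sq a * sq b) (dot a b) (\sum_t M a t ^+ 2 * M b t ^+ 2) => p q r p0 q0 r0 rp qp.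
have Dr : `|Delta * r| <= `|Delta| * p by rewrite normrM (ger0_norm r0) ler_wpM2l.
apply: le_trans (ler_normD _ _) _; rewrite ger0_norm; last first.
  by rewrite -expr2 !addr_ge0.
by rewrite mulrDl lerD// -expr2; lra.
Qed.

Lemma quad_swap a b :
  quad (a, b, a, b) = quad (a, a, b, b) /\ quad (a, b, b, a) = quad (a, a, b, b).
Proof.
have dotC : dot b a = dot a b by apply: eq_bigr => t _; rewrite mulrC.
rewrite !quadE dotC; split; congr (_ + _ * _); try ring;
  by apply: eq_bigr => t _; ring.
Qed.

(** Each of the two vectors contributes one factor 3 + |Delta|: [quad_le] accounts for the inner
    one, the three pairings and the diagonal of the outer [kappa] for the other. *)
Lemma sum_quad_le :
  \sum_(s : J4) kappa s.1.1.1 s.1.1.2 s.1.2 s.2 * quad s <=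
  (3 + `|Delta|) ^+ 2 * (\sum_s \sum_t M s t ^+ 2) ^+ 2.
Proof.
set B := 3 + _; have B0 : 0 <= B by rewrite addr_ge0.
rewrite sum_kappa.
have qle a b : quad (a, a, b, b) + quad (a, b, a, b) + quad (a, b, b, a) <=
    3 * (B * (sq a * sq b)).
  have H s : `|quad s| <= B * (sq a * sq b) -> quad s <= B * (sq a * sq b).
    exact/le_trans/ler_norm.
  rewrite [leRHS](_ : _ = B * (sq a * sq b) + B * (sq a * sq b)
    + B * (sq a * sq b)); last by ring.
  by have [-> ->] := quad_swap a b; rewrite !lerD// H// quad_le.
have dle : Delta * (\sum_a quad (a, a, a, a)) <=
    `|Delta| * (B * \sum_a \sum_b sq a * sq b).
  apply: le_trans (ler_norm _) _; rewrite normrM ler_wpM2l//.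
  apply: le_trans (ler_norm_sum _ _ _) _; rewrite mulr_sumr; apply: ler_sum => a _.
  apply: le_trans (quad_le a a) _.
  rewrite ler_wpM2l// [leRHS](bigD1 a)//= lerDl sumr_ge0// => b _.
  by rewrite mulr_ge0// sumr_ge0// => t _; exact: sqr_ge0.
apply: le_trans (lerD (ler_sum _ (fun a _ => ler_sum _ (fun b _ => qle a b))) dle) _.
under eq_bigr do rewrite -!mulr_sumr.
rewrite -!mulr_sumr -big_distrlr/= -expr2 -mulr_suml -expr2.
by rewrite le_eqVlt; apply/orP; left; apply/eqP; rewrite /B; ring.
Qed.

End FourthOrderAlgebra.

Section BilinearForms.
Context {R : realType} d (T : measurableType d) (P : probability T R).
Variables (m : nat) (Delta : R) (I : finType) (X : I -> {RV P >-> m.-tuple R}).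
Hypothesis X_iid : iid X.
Hypothesis X_std : forall i, standardized P (X i).
Hypothesis X_mom : forall i, moment_conditions P Delta (X i).
Local Notation L1 Y := (P.-integrable [set: T] (EFin \o Y)).

Definition joint_monomial (r : seq (I * 'I_m)) (w : T) : R :=
  \prod_(q <- r) tnth (X q.1 w) q.2.

Definition factor (r : seq (I * 'I_m)) (x : I) := [seq q.2 | q <- r & q.1 == x].

(** Four is the degree up to which the moments of a single vector are known to be finite. *)
Definition admissible r := forall x, (size (factor r x) <= 4)%N.

Lemma joint_monomialE r w :
  joint_monomial r w = \prod_x monomial (factor r x) (X x w).
Proof.
rewrite /joint_monomial; elim: r => [|[i s] r IH].
  by rewrite big_nil big1// => x _; rewrite /monomial big_nil.
rewrite big_cons IH [RHS](bigD1 i)//= /factor/= eqxx /monomial big_cons -mulrA.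
rewrite -/(monomial _ _) -/(factor r i) (bigD1 i)//=; congr (_ * (_ * _)).
by apply: eq_bigr => x xi; rewrite eq_sym (negbTE xi).
Qed.

Lemma integrable_joint_monomial r : admissible r -> L1 (joint_monomial r).
Proof.
move=> ar; rewrite (_ : joint_monomial r =
  (fun w => \prod_x monomial (factor r x) (X x w))).
  apply: (integrable_indep_prod X_iid (F := fun x => monomial (factor r x))).
    by move=> x; exact: measurable_monomial.
  by move=> x; exact: (integrable_monomial (X_mom x)).
by apply/funext => w; exact: joint_monomialE.
Qed.

Lemma Rintegral_joint_monomial r : admissible r ->
  \int[P]_w joint_monomial r w = \prod_x \int[P]_w monomial (factor r x) (X x w).
Proof.
move=> ar; under eq_Rintegral do rewrite joint_monomialE.
apply: (Rintegral_indep_prod X_iid (F := fun x => monomial (factor r x))).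
  by move=> x; exact: measurable_monomial.
by move=> x; exact: (integrable_monomial (X_mom x)).
Qed.

Lemma joint_monomial_cat r1 r2 w :
  joint_monomial (r1 ++ r2) w = joint_monomial r1 w * joint_monomial r2 w.
Proof. exact: big_cat. Qed.

Variable M : 'M[R]_m.
Local Notation theta := (\sum_s \sum_t M s t ^+ 2).

Definition bil i j w : R :=
  \sum_s tnth (X i w) s * \sum_t M s t * tnth (X j w) t.

Local Notation V := ('I_m * 'I_m)%type.
Local Notation J4 := ('I_m * 'I_m * 'I_m * 'I_m)%type.

Lemma bilE i j w : bil i j w =
  \sum_(a : V) M a.1 a.2 * joint_monomial [:: (i, a.1); (j, a.2)] w.
Proof.
rewrite -(pair_bigA _ (fun s t => M s t * joint_monomial [:: (i, s); (j, t)] w)).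
apply: eq_bigr => s _; rewrite mulr_sumr; apply: eq_bigr => t _ /=.
by rewrite /joint_monomial !big_cons big_nil /=; ring.
Qed.

Definition pairs i j k l (a : V * V) : seq (I * 'I_m) :=
  [:: (i, a.1.1); (j, a.1.2); (k, a.2.1); (l, a.2.2)].

Lemma bil_mulE i j k l w : bil i j w * bil k l w =
  \sum_(a : V * V) (M a.1.1 a.1.2 * M a.2.1 a.2.2) * joint_monomial (pairs i j k l a) w.
Proof.
rewrite !bilE big_distrlr pair_bigA/=; apply: eq_bigr => a _.
by rewrite /joint_monomial !big_cons big_nil /=; ring.
Qed.

Lemma bil_mul2E i j k l w : bil i j w ^+ 2 * bil k l w ^+ 2 =
  \sum_(a : (V * V) * (V * V))
    (M a.1.1.1 a.1.1.2 * M a.1.2.1 a.1.2.2 * (M a.2.1.1 a.2.1.2 * M a.2.2.1 a.2.2.2))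
    * joint_monomial (pairs i j i j a.1 ++ pairs k l k l a.2) w.
Proof.
rewrite !expr2 !bil_mulE big_distrlr pair_bigA; apply: eq_bigr => a _.
by rewrite joint_monomial_cat mulrACA.
Qed.

Let pair_le1 (i j x : I) : i != j -> ((i == x) + (j == x) <= 1)%N.
Proof.
move=> ij; case: (eqVneq i x) => [<-|_]; last by case: (_ == _).
by rewrite [j == i]eq_sym (negbTE ij).
Qed.

Lemma admissible_pairs i j k l a : admissible (pairs i j k l a).
Proof. by move=> x; rewrite size_map size_filter (leq_trans (count_size _ _)). Qed.

(** Four forms bring eight coordinates, but a form with distinct indices uses any given vector at
    most once. *)
Lemma admissible_pairs2 i j k l a b : i != j -> k != l ->
  admissible (pairs i j i j a ++ pairs k l k l b).
Proof.
move=> ij kl x; rewrite size_map size_filter /=.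
have := pair_le1 x ij; have := pair_le1 x kl; lia.
Qed.

Lemma integrable_bil_mul i j k l : L1 (fun w => bil i j w * bil k l w).
Proof.
have -> : (fun w => bil i j w * bil k l w) = _ := funext (bil_mulE i j k l).
by apply: integrable_lin => a; exact/integrable_joint_monomial/admissible_pairs.
Qed.

Lemma integrable_bil_mul2 i j k l : i != j -> k != l ->
  L1 (fun w => bil i j w ^+ 2 * bil k l w ^+ 2).
Proof.
move=> ij kl; have -> : (fun w => bil i j w ^+ 2 * bil k l w ^+ 2) = _ :=
  funext (bil_mul2E i j k l).
by apply: integrable_lin => a; exact/integrable_joint_monomial/admissible_pairs2.
Qed.

Lemma measurable_bil i j : measurable_fun [set: T] (bil i j).
Proof.
have mX k s : measurable_fun [set: T] (fun w => tnth (X k w) s).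
  apply: (measurableT_comp (@measurable_tnth _ (measurableTypeR R) _ s)).
  exact: (@measurable_funPT _ _ _ _ (X k)).
apply: measurable_sum => s; apply: measurable_funM => //.
by apply: measurable_sum => t; exact: measurable_funM.
Qed.

Lemma Rintegral_bil_sqr i j : i != j -> \int[P]_w (bil i j w ^+ 2) = theta.
Proof.
move=> ij; under eq_Rintegral do rewrite expr2 bil_mulE.
rewrite Rintegral_lin; last first.
  by move=> a; exact/integrable_joint_monomial/admissible_pairs.
have Em a : \int[P]_w joint_monomial (pairs i j i j a) w =
    (a.1.1 == a.2.1)%:R * (a.1.2 == a.2.2)%:R.
  rewrite Rintegral_joint_monomial; last exact: admissible_pairs.
  rewrite (bigD1 i)//= (bigD1 j)/=; last by rewrite eq_sym.
  rewrite /factor/= !eqxx [j == i]eq_sym (negbTE ij)/=.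
  rewrite !(moment2 (X_std _) (X_mom _)) big1 ?mulr1// => x /andP[xi xj].
  by rewrite ![_ == x]eq_sym (negbTE xi) (negbTE xj)/= moment0.
under eq_bigr do rewrite Em.
rewrite -(pair_bigA _ (fun a b : V => M a.1 a.2 * M b.1 b.2 *
   ((a.1 == b.1)%:R * (a.2 == b.2)%:R))).
rewrite [RHS]pair_bigA/=; apply: eq_bigr => a _.
rewrite -(pair_bigA _ (fun s t => M a.1 a.2 * M s t *
   ((a.1 == s)%:R * (a.2 == t)%:R)))/=.
rewrite [RHS]expr2 -[RHS](sum_delta a.1 (fun s => M a.1 a.2 * M s a.2)).
apply: eq_bigr => s _.
rewrite -(sum_delta a.2 (fun t => M a.1 a.2 * M s t)) mulr_sumr.
by apply: eq_bigr => t _; ring.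
Qed.

(** Every term of the expansion is linear in the vector [X k], which occurs nowhere else and has
    mean zero. *)
Lemma Rintegral_bil_lone i j k l : k != i -> k != j -> k != l ->
  \int[P]_w (bil i j w * bil k l w) = 0.
Proof.
move=> ki kj kl; under eq_Rintegral do rewrite bil_mulE.
rewrite Rintegral_lin; last first.
  by move=> a; exact/integrable_joint_monomial/admissible_pairs.
rewrite big1// => a _; rewrite Rintegral_joint_monomial; last exact: admissible_pairs.
rewrite (bigD1 k)//= /factor/= eqxx ![_ == k]eq_sym.
by rewrite (negbTE ki) (negbTE kj) (negbTE kl)/=
  (moment1 (X_std _) (X_mom _)) mul0r mulr0.
Qed.

Lemma Rintegral_bil_lone2 i j k l : l != i -> l != j -> l != k ->
  \int[P]_w (bil i j w * bil k l w) = 0.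
Proof.
move=> li lj lk; under eq_Rintegral do rewrite bil_mulE.
rewrite Rintegral_lin; last first.
  by move=> a; exact/integrable_joint_monomial/admissible_pairs.
rewrite big1// => a _; rewrite Rintegral_joint_monomial; last exact: admissible_pairs.
rewrite (bigD1 l)//= /factor/= eqxx ![_ == l]eq_sym.
by rewrite (negbTE li) (negbTE lj) (negbTE lk)/=
  (moment1 (X_std _) (X_mom _)) mul0r mulr0.
Qed.

Lemma Rintegral_bil_disjoint i j k l : i != j -> k != l ->
  i != k -> i != l -> j != k -> j != l ->
  \int[P]_w (bil i j w ^+ 2 * bil k l w ^+ 2) = theta ^+ 2.
Proof.
move=> ij kl ik il jk jl; under eq_Rintegral do rewrite bil_mul2E.
rewrite Rintegral_lin; last first.
  by move=> a; exact/integrable_joint_monomial/admissible_pairs2.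
transitivity (\int[P]_w (bil i j w * bil i j w) *
    \int[P]_w (bil k l w * bil k l w)); last first.
  rewrite [RHS]expr2 -[X in _ = X * _](Rintegral_bil_sqr ij).
  rewrite -[X in _ = _ * X](Rintegral_bil_sqr kl).
  by congr (_ * _); apply: eq_Rintegral => w _; rewrite expr2.
under [in RHS]eq_Rintegral do rewrite bil_mulE.
under [X in _ = _ * X]eq_Rintegral do rewrite bil_mulE.
rewrite !Rintegral_lin;
  [|by move=> a; exact/integrable_joint_monomial/admissible_pairs..].
rewrite big_distrlr pair_bigA; apply: eq_bigr => a _.
rewrite [RHS]mulrACA; congr (_ * _).
rewrite !Rintegral_joint_monomial; try exact: admissible_pairs;
  last exact: admissible_pairs2.
rewrite -big_split; apply: eq_bigr => x _; rewrite /factor filter_cat map_cat.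
set r1 := map _ _; set r2 := map _ _.
(* No vector occurs in both halves, so for each [x] one of the two monomials is empty and the
   moments multiply. *)
have [r10|r20] : r1 = [::] \/ r2 = [::].
  rewrite /r1 /r2 /=.
  case: (eqVneq i x) => [<-|_].
    by rewrite ![_ == i]eq_sym (negbTE ik) (negbTE il); right.
  case: (eqVneq j x) => [<-|_].
    by rewrite ![_ == j]eq_sym (negbTE jk) (negbTE jl); right.
  by left.
- by rewrite r10 moment0 /= mul1r.
- by rewrite r20 cats0 moment0 /= mulr1.
Qed.

Lemma Rintegral_bil_pow4 i j : i != j ->
  \int[P]_w (bil i j w ^+ 4) <= (3 + `|Delta|) ^+ 2 * theta ^+ 2.
Proof.
move=> ij; apply: le_trans (sum_quad_le Delta M).
rewrite le_eqVlt; apply/orP; left; apply/eqP.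
pose r (s t : J4) : seq (I * 'I_m) :=
  [:: (i, s.1.1.1); (i, s.1.1.2); (i, s.1.2); (i, s.2);
      (j, t.1.1.1); (j, t.1.1.2); (j, t.1.2); (j, t.2)].
pose Mst (s t : J4) := M s.1.1.1 t.1.1.1 * M s.1.1.2 t.1.1.2 * M s.1.2 t.1.2 * M s.2 t.2.
have Er w : bil i j w ^+ 4 =
    \sum_(a : J4 * J4) Mst a.1 a.2 * joint_monomial (r a.1 a.2) w.
  rewrite -(pair_bigA _ (fun s t => Mst s t * joint_monomial (r s t) w))/=.
  rewrite exprS exprS expr2 !mulrA prod4_sum; apply: eq_bigr => s _.
  set y := fun a => \sum_t M a t * tnth (X j w) t.
  transitivity ((tnth (X i w) s.1.1.1 * tnth (X i w) s.1.1.2 * tnth (X i w) s.1.2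
      * tnth (X i w) s.2) * (y s.1.1.1 * y s.1.1.2 * y s.1.2 * y s.2)).
    by rewrite /y; ring.
  rewrite /y prod4_sum mulr_sumr; apply: eq_bigr => t _.
  by rewrite /joint_monomial !big_cons big_nil /Mst/=; ring.
have ar s t : admissible (r s t).
  move=> x; rewrite size_map size_filter /=.
  have := pair_le1 x ij; lia.
under eq_Rintegral do rewrite Er.
rewrite Rintegral_lin; last by move=> a; exact/integrable_joint_monomial.
rewrite -(pair_bigA _ (fun s t => Mst s t * \int[P]_w joint_monomial (r s t) w))/=.
apply: eq_bigr => s _; rewrite /quad mulr_sumr; apply: eq_bigr => t _.
rewrite mulrA mulrC; congr (_ * _).
rewrite Rintegral_joint_monomial// (bigD1 i)//= (bigD1 j)/=; last by rewrite eq_sym.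
rewrite /factor/= !eqxx [j == i]eq_sym (negbTE ij)/=.
rewrite !(moment4 (X_std _) (X_mom _)) big1 ?mulr1// => x /andP[xi xj].
by rewrite ![_ == x]eq_sym (negbTE xi) (negbTE xj)/= moment0.
Qed.

End BilinearForms.

(** * Deviation bounds *)

Section Markov.
Context {R : realType} d (T : measurableType d) (P : probability T R).
Local Notation L1 Y := (P.-integrable [set: T] (EFin \o Y)).

Lemma le_L1_Rintegral (Y Z : T -> R) : L1 Y -> L1 Z -> (forall w, Y w <= Z w) ->
  \int[P]_w Y w <= \int[P]_w Z w.
Proof. by move=> LY LZ YZ; apply: le_Rintegral. Qed.

Lemma integrable_sqr_sum (J : finType) (Y : J -> T -> R) :
  (forall a b, L1 (fun w => Y a w * Y b w)) -> L1 (fun w => (\sum_a Y a w) ^+ 2).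
Proof.
move=> LY; have -> : (fun w => (\sum_a Y a w) ^+ 2) =
    (fun w => \sum_(ab : J * J) 1 * (Y ab.1 w * Y ab.2 w)).
  apply/funext => w; rewrite expr2 big_distrlr pair_bigA.
  by apply: eq_bigr => ab _; rewrite mul1r.
by apply: (integrable_lin (fun=> 1)) => ab; exact: LY.
Qed.

Lemma Rintegral_sqr_sum (J : finType) (Y : J -> T -> R) :
  (forall a b, L1 (fun w => Y a w * Y b w)) ->
  \int[P]_w ((\sum_a Y a w) ^+ 2) = \sum_a \sum_b \int[P]_w (Y a w * Y b w).
Proof.
move=> LY; rewrite (_ : Rintegral _ _ _ =
    \int[P]_w (\sum_(ab : J * J) 1 * (Y ab.1 w * Y ab.2 w))).
  rewrite (Rintegral_lin (fun=> 1))=> [|ab]; last exact: LY.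
  by rewrite pair_bigA; apply: eq_bigr => ab _; rewrite mul1r.
apply: eq_Rintegral => w _; rewrite expr2 big_distrlr pair_bigA.
by apply: eq_bigr => ab _; rewrite mul1r.
Qed.

Lemma measurable_deviation (Y : T -> R) l eps : measurable_fun [set: T] Y ->
  measurable [set w | eps < `|Y w - l|].
Proof.
move=> mY; rewrite (_ : [set w | _] =
    (fun w => `|Y w - l|) @^-1` `]eps, +oo[%classic); last first.
  by apply/seteqP; split=> w /=; rewrite in_itv/= andbT.
rewrite -[X in measurable X]setTI; apply: measurableT_comp => //.
exact: measurable_funB.
Qed.

(** Markov's inequality for an error with one part controlled in L^2 and a nonnegative part
    controlled in L^1. AM-GM turns the first into a quadratic term at the cost of eps / 2, so the
    single variable [H], scaled to be at least 1 on the event, dominates its indicator. *)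
Lemma deviation_bound (Y A u : T -> R) (k eps : R) : 0 < eps ->
  measurable_fun [set: T] Y -> L1 (fun w => A w ^+ 2) -> L1 u ->
  (forall w, 0 <= u w) ->
  (forall w, `|Y w - 1| <= k * `|A w| + u w) ->
  (P [set w | (eps < `|Y w - 1|)%R] <=
   (2 / eps * (k ^+ 2 / (2 * eps) * \int[P]_w (A w ^+ 2) + \int[P]_w u w))%:E)%E.
Proof.
move=> e0 mY LA Lu u0 YA; set S := [set w | _].
have mS : measurable S by exact: measurable_deviation.
pose H w := 2 / eps * (k ^+ 2 / (2 * eps) * A w ^+ 2 + u w).
have LH : L1 H by apply: L1Z; apply: L1D => //; exact: L1Z.
have k0 : 0 <= k ^+ 2 / (2 * eps) by rewrite divr_ge0 ?sqr_ge0// mulr_ge0// ltW.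
have H0 w : 0 <= H w.
  by rewrite mulr_ge0 ?divr_ge0 ?(ltW e0)// addr_ge0// mulr_ge0 ?sqr_ge0.
rewrite -RintegralZl// -RintegralD//; last exact: L1Z.
rewrite -RintegralZl//; last by apply: L1D => //; exact: L1Z.
rewrite -[X in P X]setIT -integral_indic// /Rintegral fineK;
  last exact: integrable_fin_num LH.
apply: ge0_le_integral => //.
- exact/measurable_EFinP.
- by case/integrableP: LH.
move=> w _; rewrite lee_fin indicE; case: (boolP (w \in S)) => [|_]; last exact: H0.
rewrite inE /S /= => eY; have eA := lt_le_trans eY (YA w).
(* AM-GM: [k |A| <= eps / 2 + k^2 A^2 / (2 eps)] *)
have amgm : k * `|A w| <= eps / 2 + k ^+ 2 / (2 * eps) * A w ^+ 2.
  rewrite -(real_normK (num_real (A w))) -subr_ge0.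
  rewrite (_ : _ - _ = (eps - k * `|A w|) ^+ 2 / (2 * eps)).
    by rewrite divr_ge0 ?sqr_ge0// mulr_ge0// ltW.
  by field; rewrite gt_eqF.
rewrite -(ler_pM2l (_ : 0 < eps / 2)) ?divr_gt0// mulr1 mulrA.
rewrite (_ : eps / 2 * (2 / eps) = 1); last by field; rewrite gt_eqF.
by rewrite mul1r; lra.
Qed.

End Markov.

Section SecondOrder.
Context {R : realType} d (T : measurableType d) (P : probability T R).
Variables (m : nat) (Delta : R) (I : finType) (X : I -> {RV P >-> m.-tuple R}).
Hypothesis X_iid : iid X.
Hypothesis X_std : forall i, standardized P (X i).
Hypothesis X_mom : forall i, moment_conditions P Delta (X i).
Local Notation L1 Y := (P.-integrable [set: T] (EFin \o Y)).
Variable M : 'M[R]_m.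
Local Notation theta := (\sum_s \sum_t M s t ^+ 2).
Local Notation bil := (bil X M).
Local Notation K := ((3 + `|Delta|) ^+ 2).

Let theta_ge0 : 0 <= theta.
Proof. by rewrite sumr_ge0// => s _; rewrite sumr_ge0// => t _; exact: sqr_ge0. Qed.

Lemma L1_bil_sqr i j : L1 (fun w => bil i j w ^+ 2).
Proof.
rewrite (_ : (fun w => _) = (fun w => bil i j w * bil i j w)).
  exact: (integrable_bil_mul X_iid X_mom).
by apply/funext => w; rewrite expr2.
Qed.

(** If the index pairs agree as sets, AM-GM bounds the product by the two second moments; equality
    may fail for exchanged indices, since [M] need not be symmetric. Otherwise an index of the
    second form is alone and the integral is zero. *)
Lemma Rintegral_bil_mul_le i j k l : i != j -> k != l ->
  \int[P]_w (bil i j w * bil k l w) <=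
  (((i == k) && (j == l)) + ((i == l) && (j == k)))%:R * theta.
Proof.
move=> ij kl.
have Eij := Rintegral_bil_sqr X_iid X_std X_mom M ij.
have Ekl := Rintegral_bil_sqr X_iid X_std X_mom M kl.
have [|notsame] := boolP (((i == k) && (j == l)) || ((i == l) && (j == k))).
  move=> same; apply: (@le_trans _ _ theta); last first.
    by rewrite ler_peMl// ler1n; move: same; do 2 case: (_ && _).
  have -> : theta = \int[P]_w (2^-1 * bil i j w ^+ 2 + 2^-1 * bil k l w ^+ 2).
    rewrite RintegralD//; [|exact/L1Z/L1_bil_sqr..].
    rewrite !RintegralZl//; [|exact: L1_bil_sqr..].
    by rewrite Eij Ekl; lra.
  apply: le_L1_Rintegral; first exact: (integrable_bil_mul X_iid X_mom).
    by apply: L1D; exact/L1Z/L1_bil_sqr.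
  by move=> w; have := sqr_ge0 (bil i j w - bil k l w); lra.
apply: (@le_trans _ _ 0); last by rewrite mulr_ge0.
rewrite le_eqVlt; apply/orP; left; apply/eqP.
have [ki|ki] := eqVneq k i; last first.
  have [kj|kj] := eqVneq k j; last exact: (Rintegral_bil_lone X_iid X_std X_mom).
  apply: (Rintegral_bil_lone2 X_iid X_std X_mom); last by rewrite eq_sym.
    by apply: contraNneq notsame => ->; rewrite kj !eqxx orbT.
  by rewrite -kj eq_sym.
apply: (Rintegral_bil_lone2 X_iid X_std X_mom); last by rewrite eq_sym.
  by rewrite -ki eq_sym.
by apply: contraNneq notsame => ->; rewrite ki !eqxx.
Qed.

Lemma L1_cov i j k l : i != j -> k != l ->
  L1 (fun w => (bil i j w ^+ 2 - theta) * (bil k l w ^+ 2 - theta)).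
Proof.
move=> ij kl.
rewrite (_ : (fun w => _) = (fun w => bil i j w ^+ 2 * bil k l w ^+ 2
   - (theta * bil i j w ^+ 2 + theta * bil k l w ^+ 2) + theta ^+ 2)).
  apply: L1D; last exact: L1_cst.
  apply: L1B; first exact: (integrable_bil_mul2 X_iid X_mom).
  by apply: L1D; apply: L1Z; exact: L1_bil_sqr.
by apply/funext => w; ring.
Qed.

(** For disjoint pairs the covariance is zero. Otherwise the term - theta^2 is dropped and AM-GM
    reduces the rest to fourth moments. Counting coincidences, rather than testing for overlap,
    gives a coefficient that is easy to sum. *)
Lemma Rintegral_cov_le i j k l : i != j -> k != l ->
  \int[P]_w ((bil i j w ^+ 2 - theta) * (bil k l w ^+ 2 - theta)) <=
  ((i == k) + (i == l) + (j == k) + (j == l))%:R * (K * theta ^+ 2).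
Proof.
move=> ij kl.
have Eij := Rintegral_bil_sqr X_iid X_std X_mom M ij.
have Ekl := Rintegral_bil_sqr X_iid X_std X_mom M kl.
have L22 := integrable_bil_mul2 X_iid X_mom M ij kl.
have -> : \int[P]_w ((bil i j w ^+ 2 - theta) * (bil k l w ^+ 2 - theta)) =
    \int[P]_w (bil i j w ^+ 2 * bil k l w ^+ 2) - theta ^+ 2.
  under eq_Rintegral => w _.
    rewrite (_ : _ * _ = bil i j w ^+ 2 * bil k l w ^+ 2
     - (theta * bil i j w ^+ 2 + theta * (bil k l w ^+ 2 - theta))); last by ring.
    over.
  have Lkl : L1 (fun w => bil k l w ^+ 2 - theta).
    by apply: L1B; [exact: L1_bil_sqr|exact: L1_cst].
  rewrite RintegralB//; last by apply: L1D; apply: L1Z => //; exact: L1_bil_sqr.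
  rewrite RintegralD//; [|apply: L1Z => //; exact: L1_bil_sqr..].
  rewrite !RintegralZl//; last exact: L1_bil_sqr.
  rewrite RintegralB//; [|exact: L1_bil_sqr|exact: L1_cst].
  by rewrite Rintegral_probability_cst Eij Ekl; ring.
have [dis|] := boolP [&& i != k, i != l, j != k & j != l].
  have [ik il jk jl] := and4P dis.
  rewrite (Rintegral_bil_disjoint X_iid X_std X_mom)// subrr.
  by rewrite !mulr_ge0// ?sqr_ge0.
rewrite !negb_and !negbK => ov.
apply: (@le_trans _ _ (K * theta ^+ 2)); last first.
  rewrite ler_peMl ?mulr_ge0 ?sqr_ge0// ler1n.
  by move: ov; do 4 case: (_ == _).
apply: (@le_trans _ _ (\int[P]_w (bil i j w ^+ 2 * bil k l w ^+ 2))).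
  by rewrite gerBl sqr_ge0.
have L4 a b : a != b -> L1 (fun w => bil a b w ^+ 4).
  move=> ab; rewrite (_ : (fun w => _) = (fun w => bil a b w ^+ 2 * bil a b w ^+ 2)).
    exact: (integrable_bil_mul2 X_iid X_mom).
  by apply/funext => w; ring.
apply: (@le_trans _ _ (\int[P]_w (2^-1 * bil i j w ^+ 4 + 2^-1 * bil k l w ^+ 4))).
  apply: le_L1_Rintegral => //.
    by apply: L1D; apply: L1Z; exact: L4.
  move=> w; have := sqr_ge0 (bil i j w ^+ 2 - bil k l w ^+ 2); nra.
rewrite RintegralD//; [|apply: L1Z; exact: L4..].
rewrite !RintegralZl//; [|exact: L4..].
have := Rintegral_bil_pow4 X_iid X_std X_mom M ij.
have := Rintegral_bil_pow4 X_iid X_std X_mom M kl.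
lra.
Qed.

End SecondOrder.

(** * Deterministic bounds for the distance of the ratios from 1 *)

Section RatioAlgebra.
Variable R : realType.

(** With [r] the quotient of the normalizations, the error is r A + (r - 1) plus corrections scaled
    by [r]. The constant 4 bounds [r], because x <= 2 (x - 1) and y <= 2 (y - 1). *)
Lemma cross_ratio_dist (x y t S P1 P2 Q : R) :
  2 <= x -> 2 <= y -> 0 < t -> 0 <= P1 -> 0 <= P2 -> 0 <= Q ->
  `|(x - 1)^-1 * (y - 1)^-1 * (S - y^-1 * P1 - x^-1 * P2 + x^-1 * y^-1 * Q) / t - 1|
  <= 4 * `|(S - x * y * t) / (x * y * t)| +
     (4 * (x^-1 + y^-1) +
      4 * (y^-1 * P1 / (x * y * t) + x^-1 * P2 / (x * y * t)
           + x^-1 * y^-1 * Q / (x * y * t))).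
Proof.
move=> x2 y2 t0 P10 P20 Q0.
have x0 : 0 < x by lra.
have y0 : 0 < y by lra.
have x1 : 0 < x - 1 by lra.
have y1 : 0 < y - 1 by lra.
have xyt : 0 < x * y * t by rewrite !mulr_gt0.
pose r := x * y / ((x - 1) * (y - 1)).
set A := (S - _) / _.
set b1 := y^-1 * P1 / _; set b2 := x^-1 * P2 / _; set b3 := _ * Q / _.
rewrite (_ : _ / t - 1 = r * A + (r - 1) - r * b1 - r * b2 + r * b3); last first.
  rewrite /r /A /b1 /b2 /b3; field.
  by rewrite !gt_eqF.
have r0 : 0 < r by rewrite divr_gt0// mulr_gt0.
have r4 : r <= 4.
  rewrite ler_pdivrMr ?mulr_gt0//.
  have := mulr_ge0 (_ : 0 <= x - 2) (_ : 0 <= y - 2); nra.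
have r1 : 0 <= r - 1 <= 4 * (x^-1 + y^-1).
  rewrite (_ : r - 1 = (x + y - 1) / ((x - 1) * (y - 1))); last first.
    by rewrite /r; field; rewrite !gt_eqF.
  rewrite (_ : _ + y^-1 = (x + y) / (x * y)); last by field; rewrite !gt_eqF.
  rewrite divr_ge0 ?mulr_ge0 ?(ltW x1) ?(ltW y1)//=; last lra.
  rewrite mulrA ler_pdivrMr ?mulr_gt0// mulrAC ler_pdivlMr ?mulr_gt0//.
  have h : x * y <= 4 * ((x - 1) * (y - 1)) by nra.
  have : (x + y - 1) * (x * y) <= (x + y) * (4 * ((x - 1) * (y - 1))).
    by apply: ler_pM => //; rewrite ?mulr_ge0//; lra.
  lra.
have rb b : 0 <= b -> 0 <= r * b <= 4 * b.
  by move=> b0; rewrite mulr_ge0 ?(ltW r0)//= ler_wpM2r.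
have b10 : 0 <= b1 by rewrite divr_ge0 ?(ltW xyt)// mulr_ge0// invr_ge0 ltW.
have b20 : 0 <= b2 by rewrite divr_ge0 ?(ltW xyt)// mulr_ge0// invr_ge0 ltW.
have b30 : 0 <= b3 by rewrite divr_ge0 ?(ltW xyt)// !mulr_ge0 ?invr_ge0// ltW.
have rA : `|r * A| <= 4 * `|A| by rewrite normrM gtr0_norm// ler_wpM2r.
move: (rb _ b10) (rb _ b20) (rb _ b30) r1 rA; rewrite ler_norml.
move: (r * A) (r * b1) (r * b2) (r * b3) => A' b1' b2' b3'.
by move=> /andP[? ?] /andP[? ?] /andP[? ?] /andP[? ?] /andP[? ?]; rewrite ler_norml; lra.
Qed.

(** The constants are dictated by x = 4, the smallest size allowed: there r = 3, x = 4 (x - 3) and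
    x^2 = 8 (x - 2) (x - 3), and these become upper bounds for larger x. *)
Lemma trsq_ratio_dist (x t S P Q : R) :
  4 <= x -> 0 < t -> 0 <= P -> 0 <= Q ->
  `|((x - 2) * S - 2 * P + (x - 1)^-1 * Q) / (x * (x - 2) * (x - 3)) / t - 1|
  <= 3 * `|(S - x * (x - 1) * t) / (x * (x - 1) * t)| +
     (8 / x + (16 / x ^+ 3 * (P / t) + 16 / x ^+ 3 * (Q / t))).
Proof.
move=> x4 t0 P0 Q0.
have x0 : 0 < x by lra.
have x1 : 0 < x - 1 by lra.
have x2 : 0 < x - 2 by lra.
have x3 : 0 < x - 3 by lra.
pose r := (x - 1) / (x - 3).
pose k1 := 2 / (x * (x - 2) * (x - 3)).
pose k2 := (x - 1)^-1 / (x * (x - 2) * (x - 3)).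
set A := (S - _) / _.
rewrite (_ : _ / t - 1 = r * A + (r - 1) - k1 * (P / t) + k2 * (Q / t)); last first.
  rewrite /r /A /k1 /k2; field.
  by rewrite !gt_eqF.
have r0 : 0 < r by rewrite divr_gt0.
have r3 : r <= 3 by rewrite ler_pdivrMr//; lra.
have r1 : 0 <= r - 1 <= 8 / x.
  rewrite (_ : r - 1 = 2 / (x - 3)); last by rewrite /r; field; rewrite gt_eqF.
  rewrite divr_ge0 ?(ltW x3)//= ler_pdivrMr// mulrAC ler_pdivlMr//; lra.
have D0 : 0 < x * (x - 2) * (x - 3) by rewrite !mulr_gt0.
have Dge : x ^+ 3 <= 8 * (x * (x - 2) * (x - 3)).
  rewrite exprS expr2 [leRHS](_ : _ = x * (8 * ((x - 2) * (x - 3)))); last by ring.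
  rewrite ler_wpM2l ?(ltW x0)//; nra.
have k1_le : 0 <= k1 <= 16 / x ^+ 3.
  rewrite divr_ge0 ?(ltW D0)//= ler_pdivrMr// mulrAC ler_pdivlMr ?exprn_gt0//.
  lra.
have k2_le : 0 <= k2 <= 16 / x ^+ 3.
  have x1V : (x - 1)^-1 <= 1 by rewrite invf_le1//; lra.
  have x1V0 : 0 <= (x - 1)^-1 by rewrite invr_ge0 ltW.
  rewrite divr_ge0 ?(ltW D0)//= ler_pdivrMr// mulrAC ler_pdivlMr ?exprn_gt0//.
  apply: (@le_trans _ _ (x ^+ 3)); first by rewrite ler_piMl// exprn_ge0 ?ltW.
  lra.
have Pt : 0 <= P / t by rewrite divr_ge0// ltW.
have Qt : 0 <= Q / t by rewrite divr_ge0// ltW.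
have rA : `|r * A| <= 3 * `|A| by rewrite normrM gtr0_norm// ler_wpM2r.
have kP : 0 <= k1 * (P / t) <= 16 / x ^+ 3 * (P / t).
  by case/andP: k1_le => ? ?; rewrite mulr_ge0//= ler_wpM2r.
have kQ : 0 <= k2 * (Q / t) <= 16 / x ^+ 3 * (Q / t).
  by case/andP: k2_le => ? ?; rewrite mulr_ge0//= ler_wpM2r.
move: r1 rA kP kQ; rewrite ler_norml.
move: (r * A) (k1 * (P / t)) (k2 * (Q / t)) => A' b1' b2'.
move: (16 / x ^+ 3 * (P / t)) (16 / x ^+ 3 * (Q / t)) => b3' b4'.
by move=> /andP[? ?] /andP[? ?] /andP[? ?] /andP[? ?]; rewrite ler_norml; lra.
Qed.

End RatioAlgebra.

Section Deviation.
Context {R : realType} d (T : measurableType d) (P : probability T R).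
Variables (m : nat) (Delta : R) (I : finType) (X : I -> {RV P >-> m.-tuple R}).
Hypothesis X_iid : iid X.
Hypothesis X_std : forall i, standardized P (X i).
Hypothesis X_mom : forall i, moment_conditions P Delta (X i).
Local Notation L1 Y := (P.-integrable [set: T] (EFin \o Y)).
Variable M : 'M[R]_m.
Local Notation theta := (\sum_s \sum_t M s t ^+ 2).
Local Notation bil := (bil X M).
Local Notation K := ((3 + `|Delta|) ^+ 2).
Hypothesis theta_gt0 : 0 < theta.

(* The larger of the constants of cross_deviation and within_deviation. *)
Definition rate (eps : R) : R := 2 / eps * (72 / eps * K + 72).

Lemma rate_ge0 eps : 0 < eps -> 0 <= rate eps.
Proof.
move=> e0; rewrite mulr_ge0 ?divr_ge0 ?(ltW e0)// addr_ge0// mulr_ge0 ?sqr_ge0//.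
by rewrite divr_ge0 ?ltW.
Qed.

Lemma integrable_fsum (J : finType) (Y : J -> T -> R) :
  (forall j, L1 (Y j)) -> L1 (fun w => \sum_j Y j w).
Proof.
move=> LY; rewrite (_ : (fun w => _) = (fun w => \sum_j 1 * Y j w)).
  exact: integrable_lin.
by apply/funext => w; apply: eq_bigr => j _; rewrite mul1r.
Qed.

Lemma Rintegral_fsum (J : finType) (Y : J -> T -> R) :
  (forall j, L1 (Y j)) -> \int[P]_w (\sum_j Y j w) = \sum_j \int[P]_w Y j w.
Proof.
move=> LY; rewrite (_ : Rintegral _ _ _ = \int[P]_w (\sum_j 1 * Y j w)).
  by rewrite Rintegral_lin//; apply: eq_bigr => j _; rewrite mul1r.
by apply: eq_Rintegral => w _; apply: eq_bigr => j _; rewrite mul1r.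
Qed.

Lemma Rintegral_affine (k0 k1 k2 k3 : R) (Y1 Y2 Y3 : T -> R) : L1 Y1 -> L1 Y2 -> L1 Y3 ->
  let Z w := k0 + (k1 * Y1 w + (k2 * Y2 w + k3 * Y3 w)) in
  L1 Z /\ \int[P]_w Z w = k0 + (k1 * \int[P]_w Y1 w
    + (k2 * \int[P]_w Y2 w + k3 * \int[P]_w Y3 w)).
Proof.
move=> L_1 L_2 L_3 Z.
have L23 : L1 (fun w => k2 * Y2 w + k3 * Y3 w) by apply: L1D; exact: L1Z.
have L123 : L1 (fun w => k1 * Y1 w + (k2 * Y2 w + k3 * Y3 w)).
  by apply: L1D => //; exact: L1Z.
split; first by apply: L1D => //; exact: L1_cst.
rewrite RintegralD//; last exact: L1_cst.
rewrite Rintegral_probability_cst RintegralD//; last exact: L1Z.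
by rewrite RintegralD//; [rewrite !RintegralZl|exact: L1Z..].
Qed.

Lemma sum_eq n (a : 'I_n) : \sum_b (a == b)%:R = 1 :> R.
Proof.
rewrite -[RHS](sum_delta a (fun=> 1)).
by apply: eq_bigr => b _; rewrite mulr1.
Qed.

Lemma sum_eq_fst n n' (a : 'I_n) : \sum_(b : 'I_n * 'I_n') (a == b.1)%:R = n'%:R :> R.
Proof.
rewrite -(pair_bigA _ (fun i j => (a == i)%:R))/=.
by under eq_bigr do rewrite sumr_const card_ord; rewrite sumrMnl sum_eq.
Qed.

Lemma sum_eq_snd n n' (a : 'I_n) : \sum_(b : 'I_n' * 'I_n) (a == b.2)%:R = n'%:R :> R.
Proof.
rewrite -(pair_bigA _ (fun i j => (a == j)%:R))/=.
by under eq_bigr do rewrite sum_eq; rewrite sumr_const card_ord.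
Qed.

Section Cross.
Variables (N N' : nat) (phi : 'I_N -> I) (psi : 'I_N' -> I).
Hypothesis phi_inj : injective phi.
Hypothesis psi_inj : injective psi.
Hypothesis phi_psi : forall i j, phi i != psi j.
Let c i j w := bil (phi i) (psi j) w.
Let x : R := N%:R.
Let y : R := N'%:R.

Let psi_phi i j : (psi j == phi i) = false.
Proof. by rewrite eq_sym; exact/negbTE. Qed.

Let Lcc (i k : 'I_N) (j l : 'I_N') : L1 (fun w => c i j w * c k l w).
Proof. exact: (integrable_bil_mul X_iid X_mom). Qed.

Let Ecc (i k : 'I_N) (j l : 'I_N') :
  \int[P]_w (c i j w * c k l w) <= (i == k)%:R * (j == l)%:R * theta.
Proof.
apply: le_trans (Rintegral_bil_mul_le X_iid X_std X_mom _ _ _) _ => //.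
rewrite !(inj_eq phi_inj) !(inj_eq psi_inj) (negbTE (phi_psi _ _)) /=.
by rewrite addn0 -mulnb natrM.
Qed.

Lemma cross_deviation eps : 0 < eps -> (1 < N)%N -> (1 < N')%N ->
  let ratio w := (x - 1)^-1 * (y - 1)^-1 *
    (\sum_i \sum_j c i j w ^+ 2 - y^-1 * \sum_i (\sum_j c i j w) ^+ 2
     - x^-1 * \sum_j (\sum_i c i j w) ^+ 2
     + x^-1 * y^-1 * (\sum_i \sum_j c i j w) ^+ 2) / theta in
  measurable_fun [set: T] ratio /\
  (P [set w | (eps < `|ratio w - 1|)%R] <= (rate eps * (x^-1 + y^-1))%:E)%E.
Proof.
move=> e0 N1 N'1 ratio.
have x2 : 2 <= x by rewrite ler_nat.
have y2 : 2 <= y by rewrite ler_nat.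
have x0 : 0 < x by lra.
have y0 : 0 < y by lra.
have xyt : 0 < x * y * theta by rewrite !mulr_gt0.
pose V (a : 'I_N * 'I_N') w := c a.1 a.2 w ^+ 2 - theta.
pose A w := (\sum_a V a w) / (x * y * theta).
pose P1 w := \sum_i (\sum_j c i j w) ^+ 2.
pose P2 w := \sum_j (\sum_i c i j w) ^+ 2.
pose Q w := (\sum_i \sum_j c i j w) ^+ 2.
pose u w := 4 * (x^-1 + y^-1) +
  4 * (y^-1 * P1 w / (x * y * theta) + x^-1 * P2 w / (x * y * theta)
       + x^-1 * y^-1 * Q w / (x * y * theta)).
have P1_ge0 w : 0 <= P1 w by apply: sumr_ge0 => i _; exact: sqr_ge0.
have P2_ge0 w : 0 <= P2 w by apply: sumr_ge0 => i _; exact: sqr_ge0.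
have Q_ge0 w : 0 <= Q w by exact: sqr_ge0.
have LP1 : L1 P1.
  by apply: integrable_fsum => i; apply: integrable_sqr_sum => j l; exact: Lcc.
have LP2 : L1 P2.
  by apply: integrable_fsum => i; apply: integrable_sqr_sum => j l; exact: Lcc.
have QE w : Q w = (\sum_(a : 'I_N * 'I_N') c a.1 a.2 w) ^+ 2.
  by rewrite /Q pair_bigA.
have LQ : L1 Q.
  by rewrite (funext QE); apply: integrable_sqr_sum => a b; exact: Lcc.
have EP1 : \int[P]_w P1 w <= x * (y * theta).
  rewrite Rintegral_fsum => [|i]; last first.
    by apply: integrable_sqr_sum => j l; exact: Lcc.
  rewrite [leRHS]mulr_natl -[in leRHS](card_ord N) -sumr_const; apply: ler_sum => i _.
  rewrite Rintegral_sqr_sum => [|j l]; last exact: Lcc.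
  rewrite [leRHS]mulr_natl -[in leRHS](card_ord N') -sumr_const; apply: ler_sum => j _.
  rewrite -[leRHS]mul1r -(sum_eq j) mulr_suml; apply: ler_sum => l _.
  by have := Ecc i i j l; rewrite eqxx mul1r.
have EP2 : \int[P]_w P2 w <= y * (x * theta).
  rewrite Rintegral_fsum => [|i]; last first.
    by apply: integrable_sqr_sum => j l; exact: Lcc.
  rewrite [leRHS]mulr_natl -[in leRHS](card_ord N') -sumr_const; apply: ler_sum => j _.
  rewrite Rintegral_sqr_sum => [|i k]; last exact: Lcc.
  rewrite [leRHS]mulr_natl -[in leRHS](card_ord N) -sumr_const; apply: ler_sum => i _.
  rewrite -[leRHS]mul1r -(sum_eq i) mulr_suml; apply: ler_sum => k _.
  by have := Ecc i k j j; rewrite eqxx mulr1.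
have EQ : \int[P]_w Q w <= x * y * theta.
  under eq_Rintegral do rewrite QE.
  rewrite Rintegral_sqr_sum => [|a b]; last exact: Lcc.
  rewrite -natrM -[X in (X * _)%N]card_ord -[X in (_ * X)%N](card_ord N') -card_prod.
  rewrite [leRHS]mulr_natl -sumr_const; apply: ler_sum => a _.
  apply: le_trans (ler_sum _ (fun b _ => Ecc _ _ _ _)) _.
  rewrite -mulr_suml -(pair_bigA _ (fun i j => (a.1 == i)%:R * (a.2 == j)%:R))/=.
  by rewrite -big_distrlr/= !sum_eq !mul1r.
have LVV a b : L1 (fun w => V a w * V b w).
  exact: (L1_cov X_iid X_mom).
have LVV2 : L1 (fun w => (\sum_a V a w) ^+ 2) by exact: integrable_sqr_sum.
have AE w : A w ^+ 2 = (x * y * theta) ^- 2 * (\sum_a V a w) ^+ 2.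
  by rewrite /A exprMn mulrC exprVn.
have LA : L1 (fun w => A w ^+ 2).
  by rewrite (funext AE); exact: L1Z.
have EA : \int[P]_w (A w ^+ 2) <= K * (x^-1 + y^-1).
  under eq_Rintegral do rewrite AE.
  rewrite RintegralZl// ler_pdivrMl ?exprn_gt0// Rintegral_sqr_sum//.
  (* A pair shares its first index with y pairs and its second with x, so the double sum is at most
     x y (x + y) K theta^2; dividing by (x y theta)^2 leaves K (1/x + 1/y). *)
  have Vle a b : \int[P]_w (V a w * V b w) <=
      ((a.1 == b.1)%:R + (a.2 == b.2)%:R) * (K * theta ^+ 2).
    apply: le_trans (Rintegral_cov_le X_iid X_std X_mom _ _ _) _ => //.
    rewrite !(inj_eq phi_inj) !(inj_eq psi_inj) (negbTE (phi_psi _ _)) psi_phi.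
    by rewrite !addn0 natrD.
  apply: le_trans (ler_sum _ (fun a _ => ler_sum _ (fun b _ => Vle a b))) _.
  under eq_bigr do rewrite -mulr_suml big_split/= sum_eq_fst sum_eq_snd.
  rewrite sumr_const card_prod !card_ord -[_ *+ _]mulr_natl natrM -/x -/y.
  rewrite le_eqVlt; apply/orP; left; apply/eqP; field.
  by rewrite !gt_eqF.
have uE w : u w = 4 * (x^-1 + y^-1) + (4 * y^-1 / (x * y * theta) * P1 w
    + (4 * x^-1 / (x * y * theta) * P2 w
       + 4 * (x^-1 * y^-1) / (x * y * theta) * Q w)).
  by rewrite /u; ring.
have [Lu Eu] := Rintegral_affine (4 * (x^-1 + y^-1)) (4 * y^-1 / (x * y * theta))
  (4 * x^-1 / (x * y * theta)) (4 * (x^-1 * y^-1) / (x * y * theta)) LP1 LP2 LQ.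
rewrite -(funext uE) in Lu.
have u_ge0 w : 0 <= u w.
  have [x0' y0' t0'] : [/\ 0 <= x, 0 <= y & 0 <= theta] by split; exact: ltW.
  rewrite uE; move: (P1_ge0 w) (P2_ge0 w) (Q_ge0 w).
  move: (P1 w) (P2 w) (Q w) => p1 p2 p3 p10 p20 p30.
  by rewrite !(addr_ge0, mulr_ge0, invr_ge0).
have {}Eu : \int[P]_w u w <= 8 * (x^-1 + y^-1) + 4 * (x^-1 * y^-1).
  under eq_Rintegral do rewrite uE.
  rewrite Eu.
  rewrite [leRHS](_ : _ = 4 * (x^-1 + y^-1)
    + (4 * y^-1 / (x * y * theta) * (x * (y * theta))
    + (4 * x^-1 / (x * y * theta) * (y * (x * theta))
       + 4 * (x^-1 * y^-1) / (x * y * theta) * (x * y * theta)))) ; last first.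
    by field; rewrite !gt_eqF.
  have [x0' y0' t0'] : [/\ 0 <= x, 0 <= y & 0 <= theta] by split; exact: ltW.
  by rewrite !lerD// ler_wpM2l// !(mulr_ge0, invr_ge0).
have AV w : A w = (\sum_i \sum_j c i j w ^+ 2 - x * y * theta) / (x * y * theta).
  rewrite /A sumrB sumr_const card_prod !card_ord -[_ *+ _]mulr_natl natrM -/x -/y.
  by rewrite [X in _ = (X - _) / _]pair_bigA.
have mratio : measurable_fun [set: T] ratio.
  have mc i j : measurable_fun [set: T] (c i j) by exact: measurable_bil.
  have mS : measurable_fun [set: T] (fun w => \sum_i \sum_j c i j w ^+ 2).
    by do 2 (apply: measurable_sum => ?); exact: measurable_funX.
  apply: measurable_funM => //; apply: measurable_funM => //.
  apply: measurable_funD; last exact: measurable_funM (L1_measurable LQ).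
  apply: measurable_funB; last exact: measurable_funM (L1_measurable LP2).
  by apply: measurable_funB => //; exact: measurable_funM (L1_measurable LP1).
have dist w : `|ratio w - 1| <= 4 * `|A w| + u w.
  by rewrite AV; exact: (cross_ratio_dist _ x2 y2 theta_gt0
    (P1_ge0 w) (P2_ge0 w) (Q_ge0 w)).
have PS := deviation_bound e0 mratio LA Lu u_ge0 dist.
split=> //; apply: le_trans PS _.
rewrite lee_fin /rate -[leRHS]mulrA ler_wpM2l ?divr_ge0 ?(ltW e0)//.
have xV : 0 <= x^-1 by rewrite invr_ge0 ltW.
have yV : 0 <= y^-1 <= 1 by rewrite invr_ge0 (ltW y0)/= invf_le1//; lra.
have xyV : x^-1 * y^-1 <= x^-1 by rewrite ler_piMr//; case/andP: yV.
have eV : 0 <= 4 ^+ 2 / (2 * eps) by rewrite divr_ge0// mulr_ge0// ltW.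
have EA' := ler_wpM2l eV EA.
have Kd : 0 <= K * (x^-1 + y^-1) by rewrite mulr_ge0 ?sqr_ge0// addr_ge0//; case/andP: yV.
apply: le_trans (lerD EA' Eu) _.
have -> : 4 ^+ 2 / (2 * eps) * (K * (x^-1 + y^-1)) = 8 * (eps^-1 * (K * (x^-1 + y^-1))).
  by field; rewrite !gt_eqF.
have -> : (72 / eps * K + 72) * (x^-1 + y^-1) =
    72 * (eps^-1 * (K * (x^-1 + y^-1))) + 72 * (x^-1 + y^-1) by ring.
have : 0 <= eps^-1 * (K * (x^-1 + y^-1)) by rewrite mulr_ge0// invr_ge0 ltW.
by case/andP: yV; lra.
Qed.

End Cross.

Section Within.
Variables (N : nat) (phi : 'I_N -> I).
Hypothesis phi_inj : injective phi.
Let c i j w := if i == j then 0 else bil (phi i) (phi j) w.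
Let x : R := N%:R.

Let cE i j w : i != j -> c i j w = bil (phi i) (phi j) w.
Proof. by rewrite /c => /negbTE ->. Qed.

Let Lcc (i k j l : 'I_N) : L1 (fun w => c i j w * c k l w).
Proof.
rewrite /c; case: eqP => _; first by under eq_fun do rewrite mul0r; exact: L1_cst.
case: eqP => _; first by under eq_fun do rewrite mulr0; exact: L1_cst.
exact: (integrable_bil_mul X_iid X_mom).
Qed.

Let Ecc (i k j l : 'I_N) : \int[P]_w (c i j w * c k l w) <=
  ((i == k)%:R * (j == l)%:R + (i == l)%:R * (j == k)%:R) * theta.
Proof.
have r0 : 0 <= ((i == k)%:R * (j == l)%:R + (i == l)%:R * (j == k)%:R) * theta.
  by rewrite mulr_ge0 ?(ltW theta_gt0)// addr_ge0// mulr_ge0.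
have [ij|ij] := eqVneq i j.
  under eq_Rintegral do rewrite {1}/c ij eqxx mul0r.
  by rewrite Rintegral_probability_cst.
have [kl|kl] := eqVneq k l.
  under eq_Rintegral do rewrite {2}/c kl eqxx mulr0.
  by rewrite Rintegral_probability_cst.
under eq_Rintegral do rewrite cE// cE//.
apply: le_trans (Rintegral_bil_mul_le X_iid X_std X_mom _ _ _) _;
  rewrite ?(inj_eq phi_inj)//.
by rewrite natrD -!mulnb !natrM.
Qed.

Lemma within_deviation eps : 0 < eps -> (3 < N)%N ->
  let ratio w :=
    ((x - 2) * \sum_i \sum_j c i j w ^+ 2 - 2 * \sum_i (\sum_j c i j w) ^+ 2
     + (x - 1)^-1 * (\sum_i \sum_j c i j w) ^+ 2)
    / (x * (x - 2) * (x - 3)) / theta in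
  measurable_fun [set: T] ratio /\
  (P [set w | (eps < `|ratio w - 1|)%R] <= (rate eps * x^-1)%:E)%E.
Proof.
move=> e0 N3 ratio.
have x4 : 4 <= x by rewrite ler_nat.
have x0 : 0 < x by lra.
have x1 : 0 < x - 1 by lra.
have x1t : 0 < x * (x - 1) * theta by rewrite !mulr_gt0.
(* On the diagonal [c] is 0 and nothing is subtracted, so [V] vanishes there; the x (x - 1) other
   entries are centred. *)
pose V (a : 'I_N * 'I_N) w := c a.1 a.2 w ^+ 2 - (a.1 != a.2)%:R * theta.
pose A w := (\sum_a V a w) / (x * (x - 1) * theta).
pose P1 w := \sum_i (\sum_j c i j w) ^+ 2.
pose Q w := (\sum_i \sum_j c i j w) ^+ 2.
pose u w := 8 / x + (16 / x ^+ 3 * (P1 w / theta) + 16 / x ^+ 3 * (Q w / theta)).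
have P1_ge0 w : 0 <= P1 w by apply: sumr_ge0 => i _; exact: sqr_ge0.
have Q_ge0 w : 0 <= Q w by exact: sqr_ge0.
have LP1 : L1 P1.
  by apply: integrable_fsum => i; apply: integrable_sqr_sum => j l; exact: Lcc.
have QE w : Q w = (\sum_(a : 'I_N * 'I_N) c a.1 a.2 w) ^+ 2.
  by rewrite /Q pair_bigA.
have LQ : L1 Q.
  by rewrite (funext QE); apply: integrable_sqr_sum => a b; exact: Lcc.
have EP1 : \int[P]_w P1 w <= x ^+ 2 * (2 * theta).
  rewrite Rintegral_fsum => [|i]; last first.
    by apply: integrable_sqr_sum => j l; exact: Lcc.
  rewrite expr2 -mulrA [leRHS]mulr_natl -[in leRHS](card_ord N) -sumr_const.
  apply: ler_sum => i _.
  rewrite Rintegral_sqr_sum => [|j l]; last exact: Lcc.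
  rewrite [leRHS]mulr_natl -[in leRHS](card_ord N) -sumr_const; apply: ler_sum => j _.
  apply: (@le_trans _ _ (\sum_l ((j == l)%:R + (i == l)%:R) * theta)).
    apply: ler_sum => l _; apply: le_trans (Ecc _ _ _ _) _.
    rewrite ler_wpM2r ?(ltW theta_gt0)// eqxx mul1r lerD2l.
    by rewrite ler_piMr// lern1; case: (_ == _).
  by rewrite -mulr_suml big_split/= !sum_eq.
have EQ : \int[P]_w Q w <= x ^+ 2 * (2 * theta).
  under eq_Rintegral do rewrite QE.
  rewrite Rintegral_sqr_sum => [|a b]; last exact: Lcc.
  rewrite expr2 -natrM -[X in (X * X)%N]card_ord -card_prod.
  rewrite [leRHS]mulr_natl -sumr_const; apply: ler_sum => a _.
  apply: le_trans (ler_sum _ (fun b _ => Ecc _ _ _ _)) _.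
  rewrite -mulr_suml big_split/=.
  rewrite -(pair_bigA _ (fun i j => (a.1 == i)%:R * (a.2 == j)%:R))/=.
  rewrite -(pair_bigA _ (fun i j => (a.1 == j)%:R * (a.2 == i)%:R))/=.
  rewrite [X in (_ + X) * _]exchange_big/=.
  by rewrite -!big_distrlr/= !sum_eq !mul1r.
have LVV a b : L1 (fun w => V a w * V b w).
  rewrite /V; have [ij|ij] := eqVneq a.1 a.2.
    under eq_fun do rewrite {1}/c ij eqxx expr0n mul0r subr0 mul0r; exact: L1_cst.
  have [kl|kl] := eqVneq b.1 b.2.
    under eq_fun do rewrite {2}/c kl eqxx expr0n mul0r subr0 mulr0; exact: L1_cst.
  under eq_fun do rewrite !mul1r !cE//.
  by apply: (L1_cov X_iid X_mom); rewrite (inj_eq phi_inj).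
have LVV2 : L1 (fun w => (\sum_a V a w) ^+ 2) by exact: integrable_sqr_sum.
have AE w : A w ^+ 2 = (x * (x - 1) * theta) ^- 2 * (\sum_a V a w) ^+ 2.
  by rewrite /A exprMn mulrC exprVn.
have LA : L1 (fun w => A w ^+ 2).
  by rewrite (funext AE); exact: L1Z.
have EA : \int[P]_w (A w ^+ 2) <= 16 * (K * x^-1).
  under eq_Rintegral do rewrite AE.
  rewrite RintegralZl// ler_pdivrMl ?exprn_gt0// Rintegral_sqr_sum//.
  (* Each of the four possible coincidences holds for x^3 pairs of pairs. The total 4 x^3, divided
     by (x (x - 1))^2, is at most 16 / x because x <= 2 (x - 1). *)
  have Vle a b : \int[P]_w (V a w * V b w) <=
      ((a.1 == b.1)%:R + (a.1 == b.2)%:R + (a.2 == b.1)%:R + (a.2 == b.2)%:R)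
      * (K * theta ^+ 2).
    have r0 : 0 <= ((a.1 == b.1)%:R + (a.1 == b.2)%:R + (a.2 == b.1)%:R + (a.2 == b.2)%:R)
        * (K * theta ^+ 2).
      by apply: mulr_ge0; [rewrite !addr_ge0|rewrite mulr_ge0 ?sqr_ge0].
    rewrite /V; have [ij|ij] := eqVneq a.1 a.2.
      under eq_Rintegral do rewrite {1}/c ij eqxx expr0n mul0r subr0 mul0r.
      by rewrite Rintegral_probability_cst.
    have [kl|kl] := eqVneq b.1 b.2.
      under eq_Rintegral do rewrite {2}/c kl eqxx expr0n mul0r subr0 mulr0.
      by rewrite Rintegral_probability_cst.
    under eq_Rintegral do rewrite !mul1r !cE//.
    apply: le_trans (Rintegral_cov_le X_iid X_std X_mom _ _ _) _;
      rewrite ?(inj_eq phi_inj)//.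
    by rewrite !natrD.
  apply: le_trans (ler_sum _ (fun a _ => ler_sum _ (fun b _ => Vle a b))) _.
  under eq_bigr do rewrite -mulr_suml !big_split/= !sum_eq_fst !sum_eq_snd.
  rewrite sumr_const card_prod !card_ord -[_ *+ _]mulr_natl natrM -/x.
  rewrite [leRHS](_ : _ = (16 * x * (x - 1) ^+ 2) * (K * theta ^+ 2)); last first.
    by field; rewrite gt_eqF.
  rewrite [leLHS](_ : _ = (4 * x ^+ 3) * (K * theta ^+ 2)); last by ring.
  apply: ler_wpM2r; first by rewrite mulr_ge0 ?sqr_ge0.
  rewrite exprS !mulrA [4 * x]mulrC [16 * x]mulrC -!mulrA ler_wpM2l ?(ltW x0)//.
  nra.
(* The summand [0 * Q w] pads [u] to the three terms of [Rintegral_affine]. *)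
have uE w : u w = 8 / x + (16 / x ^+ 3 / theta * P1 w
    + (16 / x ^+ 3 / theta * Q w + 0 * Q w)).
  by rewrite /u; ring.
have [Lu Eu] := Rintegral_affine (8 / x) (16 / x ^+ 3 / theta) (16 / x ^+ 3 / theta) 0 LP1 LQ LQ.
rewrite -(funext uE) in Lu.
have u_ge0 w : 0 <= u w.
  have [x0' t0'] : 0 <= x /\ 0 <= theta by split; exact: ltW.
  rewrite /u; move: (P1_ge0 w) (Q_ge0 w); move: (P1 w) (Q w) => p1 p2 p10 p20.
  by rewrite !(addr_ge0, mulr_ge0, invr_ge0, exprn_ge0).
have {}Eu : \int[P]_w u w <= 72 * x^-1.
  under eq_Rintegral do rewrite uE.
  rewrite Eu mul0r addr0.
  have [x0' t0'] : 0 <= x /\ 0 <= theta by split; exact: ltW.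
  rewrite [leRHS](_ : _ = 8 / x + (16 / x ^+ 3 / theta * (x ^+ 2 * (2 * theta))
    + 16 / x ^+ 3 / theta * (x ^+ 2 * (2 * theta)))) ; last first.
    by field; rewrite !gt_eqF.
  by rewrite !lerD// ler_wpM2l// !(mulr_ge0, invr_ge0, exprn_ge0).
have AV w : A w =
    (\sum_i \sum_j c i j w ^+ 2 - x * (x - 1) * theta) / (x * (x - 1) * theta).
  rewrite /A /V sumrB [X in _ = (X - _) / _]pair_bigA -mulr_suml.
  congr ((_ - _ * _) / _).
  rewrite -(pair_bigA _ (fun i j => (i != j)%:R))/=.
  under eq_bigr => i _.
    rewrite (eq_bigr (fun j => 1 - (i == j)%:R)); last first.
      by move=> j _; case: (i == j); rewrite ?subr0 ?subrr.
    rewrite sumrB sum_eq sumr_const card_ord; over.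
  by rewrite sumr_const card_ord -[LHS]mulr_natl.
have mratio : measurable_fun [set: T] ratio.
  have mc i j : measurable_fun [set: T] (c i j).
    by rewrite /c; case: eqP => _; [exact: measurable_cst|exact: measurable_bil].
  have mS : measurable_fun [set: T] (fun w => \sum_i \sum_j c i j w ^+ 2).
    by do 2 (apply: measurable_sum => ?); exact: measurable_funX.
  do 2 (apply: measurable_funM => //).
  apply: measurable_funD; last exact: measurable_funM (L1_measurable LQ).
  apply: measurable_funB; last exact: measurable_funM (L1_measurable LP1).
  exact: measurable_funM.
have dist w : `|ratio w - 1| <= 3 * `|A w| + u w.
  by rewrite AV; exact: (trsq_ratio_dist _ x4 theta_gt0 (P1_ge0 w) (Q_ge0 w)).
have PS := deviation_bound e0 mratio LA Lu u_ge0 dist.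
split=> //; apply: le_trans PS _.
rewrite lee_fin /rate -[leRHS]mulrA ler_wpM2l ?divr_ge0 ?(ltW e0)//.
(* The origin of [rate]: 9 / (2 eps) times 16 K is 72 K / eps, and the corrections contribute 8 + 32
   + 32 = 72. *)
have eV : 0 <= 3 ^+ 2 / (2 * eps) by rewrite divr_ge0// mulr_ge0// ltW.
apply: le_trans (lerD (ler_wpM2l eV EA) Eu) _.
rewrite le_eqVlt; apply/orP; left; apply/eqP.
by field; rewrite !gt_eqF.
Qed.

End Within.

End Deviation.

(** * The estimators *)

Section UnionBound.
Context {R : realType} d (T : measurableType d) (P : probability T R).

Lemma union_bound (J : finType) (B : J -> set T) (S : set T) (b : R) :
  (forall j, measurable (B j)) -> measurable S ->
  (forall j, P (B j) <= b%:E)%E -> (forall w, S w -> exists j, B j w) ->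
  (P S <= (#|J|%:R * b)%:E)%E.
Proof.
move=> mB mS PB SB.
have mU (s : seq J) : measurable (\big[setU/set0]_(j <- s) B j).
  by apply: bigsetU_measurable.
apply: (@le_trans _ _ (P (\big[setU/set0]_(j <- enum J) B j))).
  apply: le_measure; rewrite ?inE//.
  move=> w /SB[j Bj]; rewrite -bigcup_seq; exists j => //=.
  by rewrite mem_enum.
rewrite cardE; elim: (enum J) => [|j s IH].
  by rewrite big_nil measure0 /= mul0r lee_fin.
rewrite big_cons; apply: le_trans (measureU2 _ _ _) _ => //.
rewrite -natr1 mulrDl mul1r EFinD addeC; apply: leeD => //.
exact: PB.
Qed.

End UnionBound.

Section WeightedAverage.
Variables (R : realType) (J : finType).

Lemma weighted_ratio_dist (g t h : J -> R) (eps : R) :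
  (forall j, 0 <= g j) -> (forall j, 0 < t j) -> 0 < \sum_j g j * t j ->
  (forall j, `|h j / t j - 1| <= eps) ->
  `|(\sum_j g j * h j) / (\sum_j g j * t j) - 1| <= eps.
Proof.
move=> g0 t0 s0 H; set s := \sum_j _ * t _.
have -> : (\sum_j g j * h j) / s - 1 = (\sum_j (g j * t j) * (h j / t j - 1)) / s.
  have sn0 : s != 0 by rewrite gt_eqF.
  rewrite -[X in _ - X](divff sn0) -mulrBl -sumrB; congr (_ / _).
  by apply: eq_bigr => j _; field; rewrite gt_eqF.
rewrite normrM normfV (gtr0_norm s0) ler_pdivrMr// mulr_sumr.
apply: le_trans (ler_norm_sum _ _ _) _; apply: ler_sum => j _.
have gt0 : 0 <= g j * t j by rewrite mulr_ge0// ltW.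
by rewrite normrM (ger0_norm gt0) mulrC ler_wpM2r.
Qed.

End WeightedAverage.

Section Model.
Context {R : realType} d (T : measurableType d) (P : probability T R).
Variables (K : nat) (N : 'I_K -> nat) (p m : nat) (W : 'M[R]_p).
Hypothesis Wpsd : psdmx W.
Variables (mu : 'I_K -> 'cV[R]_p) (Gamma : 'I_K -> 'M[R]_(p, m)).
Variables (Sigma : 'I_K -> 'M[R]_p).
Variables (Z : forall alpha : 'I_K, 'I_(N alpha) -> {RV P >-> m.-tuple R}).
Variables (Y : forall alpha : 'I_K, 'I_(N alpha) -> T -> 'cV[R]_p).
Hypothesis hSigma : forall alpha, Gamma alpha *m (Gamma alpha)^T = Sigma alpha.
Hypothesis hY : forall alpha (i : 'I_(N alpha)) w,
  Y i w = Gamma alpha *m col_of_tuple (Z i w) + mu alpha.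
Hypothesis hiid : iid (fun j : {alpha : 'I_K & 'I_(N alpha)} => Z (tagged j)).
Hypothesis hstd : forall alpha (i : 'I_(N alpha)), standardized P (Z i).
Variable Delta : R.
Hypothesis hmom : forall alpha (i : 'I_(N alpha)), moment_conditions P Delta (Z i).

Local Notation I := {alpha : 'I_K & 'I_(N alpha)}.
Let X (j : I) : {RV P >-> m.-tuple R} := Z (tagged j).
(** The samples have different sizes; their dependent sum makes them one i.i.d. family, in which
    each sample is embedded. *)
Let emb alpha (i : 'I_(N alpha)) : I := Tagged (fun alpha => 'I_(N alpha)) i.
Let M alpha beta : 'M[R]_m := (Gamma alpha)^T *m W *m Gamma beta.
Local Notation theta alpha beta :=
  (\tr (W *m Sigma alpha *m W *m Sigma beta)).

Let X_std j : standardized P (X j). Proof. exact: hstd. Qed.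
Let X_mom j : moment_conditions P Delta (X j). Proof. exact: hmom. Qed.

Let emb_inj alpha : injective (@emb alpha).
Proof. by move=> i j /eqP; rewrite eq_Tagged => /eqP. Qed.

Let emb_neq alpha beta (i : 'I_(N alpha)) (j : 'I_(N beta)) : alpha != beta ->
  emb i != emb j.
Proof. by apply: contraNneq => /(congr1 tag)/= ->. Qed.

Let thetaE alpha beta : theta alpha beta = \sum_s \sum_t M alpha beta s t ^+ 2.
Proof. by rewrite -!hSigma mxtrace_WSigma. Qed.

Lemma theta_ge0 alpha beta : 0 <= theta alpha beta.
Proof.
by rewrite thetaE sumr_ge0// => s _; rewrite sumr_ge0// => t _; exact: sqr_ge0.
Qed.

Let formE alpha beta (i : 'I_(N alpha)) (j : 'I_(N beta)) w :
  form W (Y i w - mu alpha) (Y j w - mu beta) =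
  bil X (M alpha beta) (emb i) (emb j) w.
Proof.
rewrite !hY !addrK form_mulmx; apply: eq_bigr => s _; congr (_ * _).
  by rewrite mxE.
by apply: eq_bigr => t _; congr (_ * _); rewrite mxE.
Qed.

(** Both kinds of estimator form one family over pairs, so that the estimated variance is a single
    weighted sum. *)
Definition estimate (alpha beta : 'I_K) w : R :=
  if alpha == beta then trsq_est W (fun i => Y (alpha := alpha) i w)
  else \tr (W *m sample_cov (fun i => Y (alpha := alpha) i w)
            *m W *m sample_cov (fun i => Y (alpha := beta) i w)).

Let delta : R := \sum_alpha (N alpha)%:R^-1.

Let delta_ge alpha : (N alpha)%:R^-1 <= delta.
Proof. by rewrite /delta (bigD1 alpha)//= lerDl sumr_ge0. Qed.

Lemma estimate_deviation alpha beta eps : 0 < eps ->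
  (forall alpha, 3 < N alpha)%N -> theta alpha beta != 0 ->
  measurable_fun [set: T] (fun w => estimate alpha beta w / theta alpha beta) /\
  (P [set w | (eps < `|estimate alpha beta w / theta alpha beta - 1|)%R]
   <= (rate Delta eps * (2 * delta))%:E)%E.
Proof.
move=> e0 N3 th; have {}th : 0 < theta alpha beta.
  by rewrite lt_def th theta_ge0.
have N0 a : (0 < N a)%N by exact: ltn_trans (N3 a).
rewrite /estimate; case: eqVneq => [ab|ab].
  subst beta.
  rewrite thetaE in th *.
  have [] := within_deviation hiid X_std X_mom th (@emb_inj alpha) e0 (N3 alpha).
  set r := (fun w => _) => mr Pr.
  have rE : (fun w => trsq_est W (fun i => Y (alpha := alpha) i w) /
      (\sum_s \sum_t M alpha alpha s t ^+ 2)) = r.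
    apply/funext => w; rewrite /r (trsq_estE Wpsd _ (mu alpha))//.
    (* With the common expression abstracted as a function of the matrix of forms, the equality
       reduces to [formE] for the entries. *)
    pose F (c : 'I_(N alpha) -> 'I_(N alpha) -> R) :=
      (((N alpha)%:R - 2) * \sum_i \sum_j c i j ^+ 2
       - 2 * \sum_i (\sum_j c i j) ^+ 2
       + ((N alpha)%:R - 1)^-1 * (\sum_i \sum_j c i j) ^+ 2)
      / ((N alpha)%:R * ((N alpha)%:R - 2) * ((N alpha)%:R - 3)).
    rewrite -[LHS]/(F _ / _) -[RHS]/(F _ / _); congr (F _ / _).
    by apply/funext => i; apply/funext => j; rewrite formE.
  have -> : [set w | eps < `|trsq_est W (fun i => Y (alpha := alpha) i w) /
      (\sum_s \sum_t M alpha alpha s t ^+ 2) - 1|] = [set w | eps < `|r w - 1|].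
    by rewrite -rE.
  rewrite rE; split=> //; apply: le_trans Pr _.
  rewrite lee_fin ler_wpM2l ?rate_ge0//; apply: le_trans (delta_ge alpha) _.
  by rewrite mulr2n mulrDl mul1r lerDl sumr_ge0.
rewrite thetaE in th *.
have [] := cross_deviation hiid X_std X_mom th (@emb_inj alpha) (@emb_inj beta)
  (fun i j => emb_neq i j ab) e0 (ltn_trans _ (N3 alpha)) (ltn_trans _ (N3 beta)) => //.
set r := (fun w => _) => mr Pr.
have rE : (fun w => \tr (W *m sample_cov (fun i => Y (alpha := alpha) i w)
            *m W *m sample_cov (fun i => Y (alpha := beta) i w)) /
    (\sum_s \sum_t M alpha beta s t ^+ 2)) = r.
  apply/funext => w; rewrite /r (mxtrace_covE Wpsd _ _ (mu alpha) (mu beta))//.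
  pose F (c : 'I_(N alpha) -> 'I_(N beta) -> R) :=
    ((N alpha)%:R - 1)^-1 * ((N beta)%:R - 1)^-1 *
    (\sum_i \sum_j c i j ^+ 2 - (N beta)%:R^-1 * \sum_i (\sum_j c i j) ^+ 2
     - (N alpha)%:R^-1 * \sum_j (\sum_i c i j) ^+ 2
     + (N alpha)%:R^-1 * (N beta)%:R^-1 * (\sum_i \sum_j c i j) ^+ 2).
  rewrite -[LHS]/(F _ / _) -[RHS]/(F _ / _); congr (F _ / _).
  by apply/funext => i; apply/funext => j; rewrite formE.
have -> : [set w | eps < `|\tr (W *m sample_cov (fun i => Y (alpha := alpha) i w)
            *m W *m sample_cov (fun i => Y (alpha := beta) i w)) /
    (\sum_s \sum_t M alpha beta s t ^+ 2) - 1|] = [set w | eps < `|r w - 1|].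
  by rewrite -rE.
rewrite rE; split=> //; apply: le_trans Pr _.
rewrite lee_fin ler_wpM2l ?rate_ge0//.
by rewrite mulr2n mulrDl mul1r lerD.
Qed.

Variables (q : nat) (Gt : 'M[R]_(q, K)).
Hypothesis q_gt0 : (0 < q)%N.
Hypothesis Gt_rank : \rank Gt = q.
Local Notation coef := (contrast_coef Gt N).

Let g (j : 'I_K * 'I_K) : R := coef j.1 j.2 ^+ 2 /
  (if j.1 == j.2 then (N j.1)%:R * ((N j.1)%:R - 1) else (N j.1)%:R * (N j.2)%:R).

Let sigma2_sum (e : 'I_K -> 'I_K -> R) :
  \sum_alpha coef alpha alpha ^+ 2 * e alpha alpha
     / ((N alpha)%:R * ((N alpha)%:R - 1))
  + \sum_alpha \sum_(beta | alpha != beta) coef alpha beta ^+ 2 * e alpha beta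
     / ((N alpha)%:R * (N beta)%:R)
  = \sum_j g j * e j.1 j.2.
Proof.
rewrite -big_split/= -(pair_bigA _ (fun i j => g (i, j) * e i j))/=.
apply: eq_bigr => alpha _; rewrite [RHS](bigD1 alpha)//= /g/= eqxx mulrAC.
congr (_ + _); apply: eq_big => beta; first by rewrite eq_sym.
by move=> ab; rewrite (negbTE ab) mulrAC.
Qed.

Let sigma2E : sigma2 W Gt N Sigma = 2 * \sum_j g j * theta j.1 j.2.
Proof.
rewrite -(sigma2_sum (fun alpha beta => theta alpha beta)) /sigma2.
congr (2 * (_ + _)); apply: eq_bigr => alpha _.
by rewrite mulmxA.
Qed.

Let sigma2_estE w : sigma2_est W Gt (fun alpha (i : 'I_(N alpha)) => Y i w) =
  2 * \sum_j g j * estimate j.1 j.2 w.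
Proof.
rewrite -(sigma2_sum (fun alpha beta => estimate alpha beta w)) /sigma2_est.
congr (2 * (_ + _)); apply: eq_bigr => alpha _; first by rewrite /estimate eqxx.
by apply: eq_bigr => beta ab; rewrite /estimate (negbTE ab).
Qed.

(** If the weighted average deviates by more than [eps], so does one of the [K * K] ratios; the
    factor [K * K] is that of the union bound. *)
Lemma sigma2_deviation eps : 0 < eps ->
  (forall alpha, 3 < N alpha)%N -> (forall alpha beta, theta alpha beta != 0) ->
  (P [set w | (eps < `|sigma2_est W Gt (fun alpha (i : 'I_(N alpha)) => Y i w)
                / sigma2 W Gt N Sigma - 1|)%R]
   <= ((K * K)%:R * (rate Delta eps * (2 * delta)))%:E)%E.
Proof.
move=> e0 N3 th.
have th0 alpha beta : 0 < theta alpha beta by rewrite lt_def th theta_ge0.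
have N1 alpha : 0 < (N alpha)%:R - 1 :> R.
  by rewrite subr_gt0 ltr1n (leq_ltn_trans _ (N3 alpha)).
have N0 alpha : 0 < (N alpha)%:R :> R.
  by rewrite ltr0n (leq_ltn_trans _ (N3 alpha)).
have den0 (j : 'I_K * 'I_K) : 0 < (if j.1 == j.2 then (N j.1)%:R * ((N j.1)%:R - 1)
    else (N j.1)%:R * (N j.2)%:R : R).
  by case: eqP => _; rewrite mulr_gt0.
have g0 j : 0 <= g j by rewrite divr_ge0 ?sqr_ge0// ltW.
have s0 : 0 < \sum_j g j * theta j.1 j.2.
  have N0' alpha : (0 < N alpha)%N by exact: leq_ltn_trans (N3 alpha).
  have [alpha ca] := contrast_coef_neq0 q_gt0 Gt_rank N0'.
  rewrite (bigD1 (alpha, alpha))//= ltr_pwDl//.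
    by rewrite mulr_gt0// /g/= divr_gt0 ?(den0 (alpha, alpha))// exprn_even_gt0.
  by rewrite sumr_ge0// => j _; rewrite mulr_ge0// ltW.
set s := \sum_j _ in s0.
have ratioE w : sigma2_est W Gt (fun alpha (i : 'I_(N alpha)) => Y i w)
    / sigma2 W Gt N Sigma = (\sum_j g j * estimate j.1 j.2 w) / s.
  rewrite sigma2_estE sigma2E -/s; field; rewrite gt_eqF//.
have mr : measurable_fun [set: T] (fun w => (\sum_j g j * estimate j.1 j.2 w) / s).
  apply: measurable_funM => //; apply: measurable_sum => j; apply: measurable_funM => //.
  have [mE _] := estimate_deviation e0 N3 (th j.1 j.2).
  have -> : estimate j.1 j.2 =
      (fun w => estimate j.1 j.2 w / theta j.1 j.2 * theta j.1 j.2).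
    by apply/funext => w; rewrite divfK.
  exact: measurable_funM.
pose B (j : 'I_K * 'I_K) := [set w | eps < `|estimate j.1 j.2 w / theta j.1 j.2 - 1|].
rewrite -[K in (K * _)%N]card_ord -[K in (_ * K)%N]card_ord -card_prod.
apply: (union_bound (B := B)) => [j||j|w].
- by apply: measurable_deviation; have [] := estimate_deviation e0 N3 (th j.1 j.2).
- rewrite (_ : [set w | _] =
    [set w | eps < `|(\sum_j g j * estimate j.1 j.2 w) / s - 1|]).
    exact: measurable_deviation.
  by apply/seteqP; split => w /=; rewrite ratioE.
- by have [_] := estimate_deviation e0 N3 (th j.1 j.2).
move=> /= ew; apply: contrapT => /forallNP nB; move: ew; apply/negP; rewrite -leNgt.
rewrite ratioE; apply: weighted_ratio_dist => // j.
by have /negP := nB j; rewrite -leNgt.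
Qed.

End Model.

(** * From the deviation bounds to convergence in probability *)

Section Convergence.
Context {R : realType}.

(** The probability is squeezed between 0 and a bound in n alone, which tends to 0 along the product
    filter through the first projection. *)
Lemma cvg_prob_bound (d : nat -> nat -> measure_display)
    (T : forall n p, measurableType (d n p)) (P : forall n p, probability (T n p) R)
    (Y : forall n p, T n p -> R) (l : R) (delta : nat -> R) :
  delta n @[n --> \oo] --> 0 ->
  (forall eps, 0 < eps -> exists C : R,
     \forall n \near \oo & p \near \oo,
       (P n p [set w | (eps < `|Y n p w - l|)%R] <= (C * delta n)%:E)%E) ->
  cvg_prob P Y l.
Proof.
move=> d0 H eps e0; have [C HC] := H _ e0.
apply: (@squeeze_cvge _ _ _ _ (fun=> 0%E) _ (fun i : nat * nat => (C * delta i.1)%:E)).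
- near=> i; rewrite measure_ge0/=.
  by near: i; exact: HC.
- exact: cvg_cst.
- have -> : 0%E = (C * 0)%:E by rewrite mulr0.
  apply: cvg_EFin; first exact: nearW.
  apply: cvgMr; apply: cvg_comp d0; exact: cvg_fst.
Unshelve. all: by end_near. Qed.

Lemma sample_size_cvg (N : nat -> nat) (tau : R) : 0 < tau ->
  (N n)%:R / n%:R @[n --> \oo] --> tau ->
  (\forall n \near \oo, (3 < N n)%N) /\ ((N n)%:R^-1 : R) @[n --> \oo] --> 0.
Proof.
move=> tau0 Ntau.
(* Half the limiting proportion is a lower bound from some n on, so the sample size grows at least
   linearly. *)
have Nbig : \forall n \near \oo, tau / 2 * n%:R < (N n)%:R :> R.
  near=> n; have n0 : 0 < n%:R :> R by near: n; exact: nbhs_infty_gtr.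
  rewrite -ltr_pdivlMr//; near: n.
  by apply: (cvgr_gt tau); rewrite ?ltr_pdivrMr//; lra.
have Nlarge (A : R) : \forall n \near \oo, A < (N n)%:R.
  near=> n; apply: (@le_lt_trans _ _ (tau / 2 * n%:R)); last by near: n.
  rewrite mulrC -ler_pdivrMr ?divr_gt0// ltW//.
  by near: n; exact: nbhs_infty_gtr.
split; first by near=> n; rewrite -(ltr_nat R); near: n; exact: Nlarge.
apply/gtr0_cvgV0; first by near=> n; near: n; exact: Nlarge.
by apply/cvgryPgt => A; exact: Nlarge.
Unshelve. all: by end_near. Qed.

End Convergence.

Theorem theorem3 (R : realType) (K q : nat) (hK : (2 <= K)%N)
  (hq : (1 <= q < K)%N)
  (Gt : 'M[R]_(q, K)) (hGt : \rank Gt = q)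
  (* sample sizes, as functions of the total sample size n *)
  (N : nat -> 'I_K -> nat)
  (hN : forall n, (\sum_alpha N n alpha)%N = n)
  (* weight matrix *)
  (f : forall p, 'I_p -> R -> R)
  (hf : forall p i, is_pdf (f p i) /\ pdf_moment2_finite (f p i))
  (W : forall p, 'M[R]_p)
  (hW : forall p, W p = weightmx (f p))
  (* data *)
  (m : nat -> nat)
  (mu : forall p, 'I_K -> 'cV[R]_p)
  (Gamma : forall p, 'I_K -> 'M[R]_(p, m p))
  (Sigma : forall p, 'I_K -> 'M[R]_p)
  (d : nat -> nat -> measure_display)
  (T : forall n p, measurableType (d n p))
  (P : forall n p, probability (T n p) R)
  (Z : forall n p (alpha : 'I_K), 'I_(N n alpha) ->
         {RV (P n p) >-> ((m p).-tuple R)})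
  (Y : forall n p (alpha : 'I_K), 'I_(N n alpha) -> T n p -> 'cV[R]_p)
  (* (A1) *)
  (hm : forall p, (p <= m p)%N)
  (hSigma : forall p alpha, Gamma p alpha *m (Gamma p alpha)^T = Sigma p alpha)
  (hY : forall n p alpha (i : 'I_(N n alpha)) w,
      Y n p alpha i w
      = Gamma p alpha *m col_of_tuple (Z n p alpha i w) + mu p alpha)
  (hiid : forall n p,
      iid (fun j : {alpha : 'I_K & 'I_(N n alpha)} =>
             Z n p (tag j) (tagged j)))
  (hstd : forall n p alpha (i : 'I_(N n alpha)),
      standardized (P n p) (Z n p alpha i))
  (* (A2) *)
  (Delta : R)
  (hmom : forall n p alpha (i : 'I_(N n alpha)),
      moment_conditions (P n p) Delta (Z n p alpha i))
  (* (A3) *)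
  (tau : 'I_K -> R)
  (htau : forall alpha, 0 < tau alpha < 1)
  (hN_tau : forall alpha,
      (N n alpha)%:R / n%:R @[n --> \oo] --> tau alpha)
  (* (A4) *)
  (hA4 : forall alpha beta gamma : 'I_K,
      (fun p => \tr (W p *m Sigma p alpha *m W p *m Sigma p beta
                     *m W p *m Sigma p gamma *m W p *m Sigma p beta))
      =o_\oo
      (fun p => \tr (W p *m Sigma p alpha *m W p *m Sigma p beta)
                * \tr (W p *m Sigma p gamma *m W p *m Sigma p beta)))
  (* the denominators of the ratios below do not vanish *)
  (hnz : forall alpha beta : 'I_K,
      \forall p \near \oo,
        \tr (W p *m Sigma p alpha *m W p *m Sigma p beta) != 0) :
  forall alpha beta : 'I_K, alpha != beta ->
  [/\ cvg_prob P (fun n p w =>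
        trsq_est (W p) (fun i => Y n p alpha i w)
        / \tr (W p *m Sigma p alpha *m (W p *m Sigma p alpha))) 1,
      cvg_prob P (fun n p w =>
        \tr (W p *m sample_cov (fun i => Y n p alpha i w)
             *m W p *m sample_cov (fun i => Y n p beta i w))
        / \tr (W p *m Sigma p alpha *m W p *m Sigma p beta)) 1 &
      cvg_prob P (fun n p w =>
        sigma2_est (W p) Gt (fun gamma i => Y n p gamma i w)
        / sigma2 (W p) Gt (N n) (Sigma p)) 1].
Proof.
move=> alpha0 beta0 ab0.
have q0 : (0 < q)%N by case/andP: hq.
have Wpsd p : psdmx (W p).
  by rewrite hW; apply: weightmx_psd => i; have [] := hf p i.
pose delta n : R := \sum_alpha (N n alpha)%:R^-1.
have tau0 alpha : 0 < tau alpha by case/andP: (htau alpha).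
have NN alpha := sample_size_cvg (tau0 alpha) (hN_tau alpha).
have delta0 : delta n @[n --> \oo] --> 0.
  have -> : 0 = \sum_(alpha < K) (0 : R) by rewrite big1.
  by apply: cvg_big => [|alpha _]; [exact: add_continuous|have [] := NN alpha].
(* There are finitely many samples, so one threshold serves them all; likewise for the pairs in
   [th]. *)
have N3 : \forall n \near \oo, forall alpha, (3 < N n alpha)%N.
  by apply: filter_forall => alpha; have [] := NN alpha.
have th : \forall p \near \oo, forall alpha beta,
    \tr (W p *m Sigma p alpha *m W p *m Sigma p beta) != 0.
  by apply: filter_forall => alpha; apply: filter_forall => beta; exact: hnz.
have dev alpha beta eps : 0 < eps -> exists C : R,
    \forall n \near \oo & p \near \oo,
    (P n p [set w | (eps <
       `|estimate (W p) (fun gamma (i : 'I_(N n gamma)) => Y n p gamma i) alpha beta w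
         / \tr (W p *m Sigma p alpha *m W p *m Sigma p beta) - 1|)%R]
     <= (C * delta n)%:E)%E.
  move=> e0; exists (rate Delta eps * 2); near=> n p; rewrite -mulrA.
  have N3n : forall alpha, (3 < N n alpha)%N by near: n.
  have thp : forall alpha beta,
    \tr (W p *m Sigma p alpha *m W p *m Sigma p beta) != 0 by near: p.
  by have [] := estimate_deviation (Wpsd p) (hSigma p) (hY n p) (hiid n p)
    (hstd n p) (hmom n p) e0 N3n (thp alpha beta).
split.
- apply: (cvg_prob_bound delta0) => eps e0; have [C HC] := dev alpha0 alpha0 _ e0.
  exists C; apply: filterS HC => -[n p] /=.
  by rewrite /estimate eqxx mulmxA.
- apply: (cvg_prob_bound delta0) => eps e0; have [C HC] := dev alpha0 beta0 _ e0.
  exists C; apply: filterS HC => -[n p] /=.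
  by rewrite /estimate (negbTE ab0).
- apply: (cvg_prob_bound delta0) => eps e0.
  exists ((K * K)%:R * (rate Delta eps * 2)).
  near=> n p.
  have -> : (K * K)%:R * (rate Delta eps * 2) * delta n =
      (K * K)%:R * (rate Delta eps * (2 * delta n)) by rewrite !mulrA.
  have N3n : forall alpha, (3 < N n alpha)%N by near: n.
  have thp : forall alpha beta,
    \tr (W p *m Sigma p alpha *m W p *m Sigma p beta) != 0 by near: p.
  exact: (sigma2_deviation (Wpsd p) (hSigma p) (hY n p) (hiid n p)
    (hstd n p) (hmom n p) q0 hGt e0 N3n thp).
Unshelve. all: by end_near. Qed.
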